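(* Let $N\ge1$ and let $\mathcal W$ be a weighting of $\mathsf{AG}_N$. Let $\mathsf{x}_i^{(j),\mathrm{sh}}(t)$, $1\le i\le j\le t\le N$, be the position of the $i$-th particle of level $j$ after $t$ steps of the shuffling algorithm for $\mathcal W$, and let $(\mathsf{Y}_i^{(j)}(t);0\le t\le N-j)_{1\le i\le j,\,1\le j\le N}$ be the sequential-update Bernoulli push-block process, started from the fully-packed configuration $\mathsf{Y}_i^{(j)}(0)=i-1$, in which a particle at space location $x$, at level $n$, at time $t$ has jump probability $\rho_{\mathcal{UR}^N_{t+n}(\mathcal W)}(x,n)$. Then, jointly in all indices, $$\left(\mathsf{Y}_i^{(j)}(t-j);1\le j\le N,1\le i\le j,j\le t\le N\right)\overset{d}{=}\left(\mathsf{x}_i^{(j),\mathrm{sh}}(t);1\le j\le N,1\le i\le j,j\le t\le N\right).$$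
   Context: Aztec diamond graph: for $k\ge1$, $0\le x\le k-1$, $1\le n\le k$, let square $(x,n)$ be the unit square with lower-left corner $(x+n-1,x-n)\in\mathbb{Z}^2$ ($x$ is the space coordinate, $n$ the level). $\mathsf{AG}_k$ has as vertices all corners and as edges all sides of these $k^2$ squares; each edge is a side of exactly one of them and is denoted $(\bullet,(x,n))$ with $\bullet\in\{\mathrm n,\mathrm s,\mathrm w,\mathrm e\}$ (north, south, west, east: the top, bottom, left, right side of square $(x,n)$). $\mathsf{DC}_k$ is the set of dimer coverings (perfect matchings) of $\mathsf{AG}_k$. A weighting $\mathcal W$ of $\mathsf{AG}_k$ is a function from its edges to $(0,\infty)$. Put $\Delta_{\mathcal W}(x,n)=\mathcal W_{\mathrm e,(x,n)}\mathcal W_{\mathrm w,(x,n)}+\mathcal W_{\mathrm s,(x,n)}\mathcal W_{\mathrm n,(x,n)}$ and $$\rho_{\mathcal W}(x,n)=\frac{\mathcal W_{\mathrm w,(x,n)}\mathcal W_{\mathrm e,(x,n)}}{\Delta_{\mathcal W}(x,n)}.$$ Urban renewal: for a weighting $\mathcal W$ of $\mathsf{AG}_{k+1}$, $\mathcal{UR}_k^{k+1}(\mathcal W)$ is the weighting of $\mathsf{AG}_k$ with, for $0\le x\le k-1$, $1\le n\le k$: west weight at $(x,n)$ equal to $\mathcal W_{\mathrm w,(x,n)}/\Delta_{\mathcal W}(x,n)$; east weight $\mathcal W_{\mathrm e,(x+1,n+1)}/\Delta_{\mathcal W}(x+1,n+1)$; north weight $\mathcal W_{\mathrm n,(x+1,n)}/\Delta_{\mathcal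 W}(x+1,n)$; south weight $\mathcal W_{\mathrm s,(x,n+1)}/\Delta_{\mathcal W}(x,n+1)$. For $k\le n$, $\mathcal{UR}^n_k=\mathcal{UR}_k^{k+1}\circ\dots\circ\mathcal{UR}^{n-1}_{n-2}\circ\mathcal{UR}^n_{n-1}$ (so $\mathcal{UR}_{n-1}^n$ is applied first), $\mathcal{UR}^n_n=\mathrm{id}$. Shuffling algorithm for a weighting $\mathcal W$ of $\mathsf{AG}_N$: step 1: cover the single square $(0,1)$ of $\mathsf{AG}_1$ by its west-east pair of edges with probability $\rho_{\mathcal{UR}^N_1(\mathcal W)}(0,1)$ and by its north-south pair otherwise, giving $\mathfrak d^{(1)}$. Given $\mathfrak d^{(k)}\in\mathsf{DC}_k$ (after $k$ steps, $k<N$): (1) embed $\mathsf{AG}_k$ into $\mathsf{AG}_{k+1}$ by the translation $v\mapsto v+(1,0)$, so $\mathfrak d^{(k)}$ becomes a set of edges of $\mathsf{AG}_{k+1}$; (2) remove all pairs of dimers that are sides of the same square of $\mathsf{AG}_{k+1}$; (3) move each remaining dimer to the opposite side of the square of $\mathsf{AG}_{k+1}$ of which it is a side; (4) the vertices of $\mathsf{AG}_{k+1}$ not covered are the corners of pairwise disjoint squares of $\mathsf{AG}_{k+1}$; independently, cover each such square $(x,n)$ by its west-east pair with probability $\rho_{\mathcal{UR}^N_{k+1}(\mathcal W)}(x,n)$ and by its north-south pair otherwise. This gives $\mathfrak d^{(k+1)}\in\mathsf{DC}_{k+1}$. Particles: to a dimer covering associate particles at the coordinates $(x,n)$ of all squares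 one of whose south or east edges is a dimer; there are exactly $n$ particles on level $n$, ordered by increasing $x$. $\mathsf{x}_i^{(j),\mathrm{sh}}(t)$ is the space coordinate of the $i$-th particle of level $j$ of $\mathfrak d^{(t)}$. The process $\mathsf Y$: with conventions $\mathsf{Y}_n^{(n-1)}=+\infty$, $\mathsf{Y}_0^{(n-1)}=-\infty$ and independent (over $i,n,t,x$) $\{0,1\}$-valued $\mathsf{B}_t^{i,(n)}(x)$ with $\mathbb{P}(\mathsf{B}_t^{i,(n)}(x)=1)=\rho_{\mathcal{UR}^N_{t+n}(\mathcal W)}(x,n)$, for $0\le t\le N-n-1$, $$\mathsf{Y}_i^{(n)}(t+1)=\min\{\mathsf{Y}_i^{(n-1)}(t+1),\max\{\mathsf{Y}_i^{(n)}(t)+\mathsf{B}_t^{i,(n)}(\mathsf{Y}_i^{(n)}(t)),\mathsf{Y}_{i-1}^{(n-1)}(t+1)+1\}\}.$$ *)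

(* Defs.v *)
From HB Require Import structures.
From mathcomp Require Import all_boot all_order all_algebra finmap.
From mathcomp Require Import all_classical all_reals all_analysis.

Set Implicit Arguments.
Unset Strict Implicit.
Unset Printing Implicit Defensive.
Import Order.TTheory GRing.Theory Num.Theory.

Local Open Scope ring_scope.

Variant side := North | South | West | East.

Definition side_ord (s : side) : 'I_4 :=
  match s with North => inord 0 | South => inord 1 | West => inord 2
             | East => inord 3 end.

Definition ord_side (i : 'I_4) : side :=
  match val i with 0%N => North | 1%N => South | 2%N => West | _ => East end.

Lemma side_ordK : cancel side_ord ord_side.
Proof. by case; rewrite /ord_side /side_ord /= inordK. Qed.

HB.instance Definition _ := Finite.copy side (can_type side_ordK).

Definition opp_side (s : side) : side :=
  match s with North => South | South => North | West => East | East => West end.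

(* The square (x, n) of AG_k, 0 <= x <= k - 1, 1 <= n <= k, is encoded as the
   pair of ordinals (x, n - 1); the level is always read through [level]. *)
Notation square k := ('I_k * 'I_k)%type.

Definition space_coord k (q : square k) : nat := q.1.
Definition level k (q : square k) : nat := q.2.+1.

(* Every edge of AG_k is a side of exactly one of the k^2 squares. *)
Notation edge k := (side * ('I_k * 'I_k))%type.

Definition vertex : Type := (int * int)%type.

Definition sw_corner k (q : square k) : vertex :=
  ((space_coord q)%:Z + (level q)%:Z - 1, (space_coord q)%:Z - (level q)%:Z).

Definition corners k (q : square k) : seq vertex :=
  let: (a, b) := sw_corner q in
  [:: (a, b); (a + 1, b); (a, b + 1); (a + 1, b + 1)].

Definition vertices (k : nat) : seq vertex :=
  undup (flatten [seq corners q | q <- enum {: square k}]).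

(* The left or bottom endpoint comes first, so that an edge of the lattice has
   only one pair of endpoints. *)
Definition endpoints k (e : edge k) : vertex * vertex :=
  let: (a, b) := sw_corner e.2 in
  match e.1 with
  | South => ((a, b), (a + 1, b))
  | North => ((a, b + 1), (a + 1, b + 1))
  | West => ((a, b), (a, b + 1))
  | East => ((a + 1, b), (a + 1, b + 1))
  end.

Definition covered k (d : {set edge k}) (v : vertex) : bool :=
  [exists e in d, (v == (endpoints e).1) || (v == (endpoints e).2)].

Section Weightings.
Variable R : realType.

(* A weighting of AG_k is given by its values [W s x n] for x < k and
   1 <= n <= k; the other values are irrelevant. *)
Definition weighting : Type := side -> nat -> nat -> R.

Definition positive_weighting (k : nat) (W : weighting) : Prop :=
  forall s x n, (x < k)%N -> (1 <= n <= k)%N -> 0 < W s x n.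

Definition Delta (W : weighting) (x n : nat) : R :=
  W East x n * W West x n + W South x n * W North x n.

Definition rho (W : weighting) (x n : nat) : R :=
  W West x n * W East x n / Delta W x n.

(* UR^{k+1}_k; the formula does not depend on k. *)
Definition UR_step (W : weighting) : weighting := fun s x n =>
  match s with
  | West => W West x n / Delta W x n
  | East => W East x.+1 n.+1 / Delta W x.+1 n.+1
  | North => W North x.+1 n / Delta W x.+1 n
  | South => W South x n.+1 / Delta W x n.+1
  end.

(* UR^n_k, for k <= n *)
Definition UR (n k : nat) (W : weighting) : weighting := iter (n - k) UR_step W.

End Weightings.

Definition translate (v : vertex) : vertex := (v.1 + 1, v.2).

Definition embed k (d : {set edge k}) : {set edge k.+1} :=
  [set e' : edge k.+1 | [exists e in d,
     endpoints e' == (translate (endpoints e).1, translate (endpoints e).2)]].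

Definition remove_pairs k (d : {set edge k}) : {set edge k} :=
  [set e in d | ~~ [exists e' in d, (e' != e) && (e'.2 == e.2)]].

Definition slide k (d : {set edge k}) : {set edge k} :=
  [set (opp_side e.1, e.2) | e in d].

(* The squares in [F] are pairwise disjoint and their corners are exactly the
   vertices of AG_k that [d] does not cover. *)
Definition tiles_uncovered k (d : {set edge k}) (F : {set square k}) : bool :=
  [forall q in F, [forall q' in F,
     (q != q') ==> ~~ has (mem (corners q')) (corners q)]] &&
  all (fun v => ~~ covered d v == [exists q in F, v \in corners q]) (vertices k).

(* In AG_k such a family is unique if it exists.  It need not consist of all the
   squares with four uncovered corners: a square from which a pair of dimers has
   just been removed may have its four corners shared with four squares of the
   family. *)
Definition uncovered_squares k (d : {set edge k}) : {set square k} :=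
  odflt finset.set0 [pick F : {set square k} | tiles_uncovered d F].

Definition we_pair k (q : square k) : {set edge k} := [set (West, q); (East, q)].
Definition ns_pair k (q : square k) : {set edge k} := [set (North, q); (South, q)].

Definition slid k (d : {set edge k}) : {set edge k.+1} :=
  slide (remove_pairs (embed d)).

(* [A] is the set of squares covered by their west-east pair. *)
Definition create k (d : {set edge k}) (A : {set square k}) : {set edge k} :=
  d :|: \bigcup_(q in A) we_pair q
    :|: \bigcup_(q in uncovered_squares d :\: A) ns_pair q.

(* Probability that a shuffling step leads from [d] in AG_k to [d'] in AG_(k+1),
   where [V] is the weighting of AG_(k+1) used in that step. *)
Definition shuffling_kernel (R : realType) (V : weighting R) k
    (d : {set edge k}) (d' : {set edge k.+1}) : R :=
  \sum_(A : {set square k.+1} |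
          (A \subset uncovered_squares (slid d)) && (d' == create (slid d) A))
    ((\prod_(q in A) rho V (space_coord q) (level q)) *
     \prod_(q in uncovered_squares (slid d) :\: A)
        (1 - rho V (space_coord q) (level q))).

Local Open Scope classical_set_scope.

Record shuffling (R : realType) (disp : measure_display) (T : measurableType disp)
    (P : probability T R) (N : nat) (W : weighting R)
    (D : forall k, T -> {set edge k}) : Prop := Shuffling {
  shuffling_measurable : forall k (e : {set edge k}), (1 <= k <= N)%N ->
    measurable (D k @^-1` [set e]);
  shuffling_init_we :
    P (D 1%N @^-1` [set we_pair (ord0, ord0)]) = (rho (UR N 1 W) 0 1)%:E;
  shuffling_init_ns :
    P (D 1%N @^-1` [set ns_pair (ord0, ord0)]) = (1 - rho (UR N 1 W) 0 1)%:E;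
  shuffling_step : forall k (e : forall l, {set edge l}), (1 <= k < N)%N ->
    P [set w | forall l, (1 <= l <= k.+1)%N -> D l w = e l] =
    (P [set w | forall l, (1 <= l <= k)%N -> D l w = e l] *
     (shuffling_kernel (UR N k.+1 W) (e k) (e k.+1))%:E)%E
}.

Definition particles k (d : {set edge k}) (j : nat) : seq nat :=
  [seq x <- iota 0 k | [exists q : square k,
     [&& space_coord q == x, level q == j & ((South, q) \in d) || ((East, q) \in d)]]].

Definition particle k (d : {set edge k}) (j i : nat) : nat :=
  nth 0%N (particles d j) i.-1.

Definition mutually_independent (R : realType) (disp disp' : measure_display)
    (T : measurableType disp) (T' : measurableType disp') (P : probability T R)
    (I : choiceType) (D : set I) (X : I -> {RV P >-> T'}) : Prop :=
  forall (J : {fset I}) (A : I -> set T'),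
    (forall i, i \in J -> D i /\ measurable (A i)) ->
    P (\bigcap_(i in [set` J]) (X i @^-1` A i)) =
    (\prod_(i <- J) P (X i @^-1` A i))%E.

(* [B (t, i, n, x)] is B_t^{i,(n)}(x), for a square (x, n) of AG_(t + n). *)
Definition jump_index (N : nat) : set (nat * nat * nat * nat) :=
  [set p | let: (t, i, n, x) := p in
     [&& (1 <= i <= n)%N, (t + n < N)%N & (x < t + n)%N]].

Definition jump_variables (R : realType) (disp : measure_display)
    (T : measurableType disp) (P : probability T R) (N : nat) (W : weighting R)
    (B : nat * nat * nat * nat -> {RV P >-> bool}) : Prop :=
  mutually_independent (jump_index N) B /\
  forall t i n x, jump_index N (t, i, n, x) ->
    P (B (t, i, n, x) @^-1` [set true]) = (rho (UR N (t + n) W) x n)%:E.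

(* Position of particle [i] of level [n] with the conventions
   Y_0^(n) = -oo and Y_(n+1)^(n) = +oo. *)
Definition ext_position (Y : nat -> nat -> nat -> nat) (n i t : nat) : \bar int :=
  if i == 0%N then -oo%E else if i == n.+1 then +oo%E else ((Y n i t)%:Z%:E)%E.

(* [Y n i t w] is Y_i^(n)(t). *)
Definition push_block (T : Type) (N : nat)
    (B : nat * nat * nat * nat -> T -> bool)
    (Y : nat -> nat -> nat -> T -> nat) : Prop :=
  (forall n i w, (1 <= i <= n)%N -> (n <= N)%N -> Y n i 0%N w = i.-1) /\
  (forall n i t w, (1 <= i <= n)%N -> (t + n < N)%N ->
    let y n' i' t' := ext_position (fun n i t => Y n i t w) n' i' t' in
    let jump : nat := B (t, i, n, Y n i t w) w in
    y n i t.+1 = Order.min (y n.-1 i t.+1)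
      (Order.max (y n i t + jump%:Z%:E)%E (y n.-1 i.-1 t.+1 + 1%:E)%E)).

(* The triples (j, i, t). *)
Definition valid_index (N : nat) : pred ('I_N.+1 * 'I_N.+1 * 'I_N.+1) :=
  fun p => let: (j, i, t) := p in [&& (1 <= i)%N, (i <= j)%N & (j <= t)%N].

Definition array_index (N : nat) : finType :=
  {p : 'I_N.+1 * 'I_N.+1 * 'I_N.+1 | valid_index p}.

Definition array (N : nat) (f : nat -> nat -> nat -> nat) :
    {ffun array_index N -> nat} :=
  [ffun p : array_index N => let: (j, i, t) := sval p in f j i t].

(* Countable value space with all subsets measurable. *)
Definition equal_in_law (R : realType) (d1 d2 : measure_display)
    (T1 : measurableType d1) (T2 : measurableType d2)
    (P1 : probability T1 R) (P2 : probability T2 R) (S : countType)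
    (X1 : T1 -> S) (X2 : T2 -> S) : Prop :=
  forall A : set S, P1 (X1 @^-1` A) = P2 (X2 @^-1` A).

(* Main.v *)
(* In a covering of AG_k, call position x of level n a particle if the vertex
   (x + n, x - n) is matched inside level n and a hole if it is matched inside
   level n + 1.  When AG_k is embedded into AG_(k+1), each dimer becomes a side of
   a square of the other colour; after removal, sliding and creation, whatever is
   created, the particles of level n <= k sit at x for each South dimer (x, n) of
   the old covering and at x + 1 for each East dimer, while level k + 1 is full.
   So the i-th particle of each level stays or jumps by one according to its type.
   The types are forced by the positions of levels n and n - 1 (this is the
   blocking and pushing of Y), except on the freshly created squares, where they
   are the independent coins of that step.  Hence given the past both arrays have
   the same one-step transition probabilities: a product over the particles.  On
   the side of Y the probability of a given array is such a product because each
   update reads one coin, and distinct updates read distinct coins. *)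

Require Import Defs.
From mathcomp Require Import all_boot all_order all_algebra finmap.
From mathcomp Require Import zify boolp reals.

Set Implicit Arguments.
Unset Strict Implicit.
Unset Printing Implicit Defensive.
Import Order.TTheory GRing.Theory Num.Theory.

Local Arguments level : simpl never.
Local Arguments space_coord : simpl never.

(** * Dimers in coordinates and the covering equations *)

Lemma side_eqE (s s' : side) : (s == s') =
  match s, s' with
  | North, North | South, South | West, West | East, East => true
  | _, _ => false
  end.
Proof. by case: s s' => [] []; apply/eqP. Qed.

(** Coordinates are plain naturals that may leave [AG_k], so that the equations below can shift them
    without casts between ordinals. *)
Definition dimer k (d : {set edge k}) (s : side) (x n : nat) : bool :=
  [exists e in d, [&& e.1 == s, space_coord e.2 == x & level e.2 == n]].

Lemma dimerP k (d : {set edge k}) s x n :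
  reflect (exists q : square k,
             [/\ (s, q) \in d, space_coord q = x & level q = n])
          (dimer d s x n).
Proof.
apply: (iffP existsP) => [[[s' q] /and4P[/= qd /eqP <- /eqP <- /eqP <-]]|].
  by exists q.
by move=> [q [qd <- <-]]; exists (s, q); rewrite qd /= !eqxx.
Qed.

Lemma square_inj k (q q' : square k) :
  space_coord q = space_coord q' -> level q = level q' -> q = q'.
Proof.
case: q q' => [x n] [x' n']; rewrite /space_coord /level /= => ? -[?].
by congr (_, _); apply: val_inj.
Qed.

Lemma dimerE k (d : {set edge k}) s q :
  dimer d s (space_coord q) (level q) = ((s, q) \in d).
Proof.
apply/dimerP/idP => [[q' [q'd xq nq]]|]; last by exists q.
by rewrite -(square_inj xq nq).
Qed.

Lemma dimer_range k (d : {set edge k}) s x n :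
  dimer d s x n -> (x < k) && (0 < n <= k).
Proof. by move=> /dimerP[[y m] [_ <- <-]]; rewrite /level /= !ltn_ord. Qed.

Lemma square_of k x n : x < k -> 0 < n <= k ->
  exists2 q : square k, space_coord q = x & level q = n.
Proof.
case: n => // n xk nk.
by exists (Ordinal xk, Ordinal (nk : n < k)).
Qed.

Lemma dimer0 k (d : {set edge k}) s x : dimer d s x 0 = false.
Proof. by case E: dimer => //; have:= dimer_range E; rewrite andbF. Qed.

Lemma dimer_ge k (d : {set edge k}) s x n :
  (k <= x) || (k < n) -> dimer d s x n = false.
Proof. by move=> H; case E: dimer => //; have:= dimer_range E; move: H; lia. Qed.

(* The fields say that the vertices [even_vertex x n], [odd_vertex 0 n] and
   [odd_vertex x.+1 n] defined below are covered exactly once; values of [dimer]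
   outside of AG_k are [false]. *)
Record matching k (d : {set edge k}) : Prop := Matching {
  matching_even : forall x n, x < k -> n <= k ->
    dimer d South x n + dimer d East x n
      + dimer d West x n.+1 + dimer d North x n.+1 = 1;
  matching_odd0 : forall n, 0 < n <= k ->
    dimer d West 0 n + dimer d South 0 n = (0 < k);
  matching_oddS : forall x n, x < k -> 0 < n <= k ->
    dimer d West x.+1 n + dimer d South x.+1 n
      + dimer d North x n + dimer d East x n = 1 }.

(** * Embedding, removal of pairs and sliding *)

Section Embed.
Variables (k : nat) (d : {set edge k}).

(** A translated square of [AG_k] has four squares of [AG_(k+1)] as neighbours, and each of its
    sides is the opposite side of one of them. *)
Lemma endpoints_embed (e' : edge k.+1) (e : edge k) :
  endpoints e' == (translate (endpoints e).1, translate (endpoints e).2) =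
  match e.1 with
  | South => [&& e'.1 == North, space_coord e'.2 == space_coord e.2
                & level e'.2 == (level e.2).+1]
  | North => [&& e'.1 == South, space_coord e'.2 == (space_coord e.2).+1
                & level e'.2 == level e.2]
  | West => [&& e'.1 == East, space_coord e'.2 == space_coord e.2
                & level e'.2 == level e.2]
  | East => [&& e'.1 == West, space_coord e'.2 == (space_coord e.2).+1
                & level e'.2 == (level e.2).+1]
  end.
Proof.
case: e' e => [s' q'] [s q] /=; rewrite /endpoints /sw_corner /translate /=.
move: (space_coord q') (level q') (space_coord q) (level q) => x' n' x n.
case: s' s => [] [] /=; rewrite !xpair_eqE !side_eqE /=; lia.
Qed.

Lemma mem_embed s' (q' : square k.+1) :
  ((s', q') \in embed d) =
  let x := space_coord q' in let n := level q' in
  match s' with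
  | North => dimer d South x (n - 1)
  | South => (0 < x) && dimer d North (x - 1) n
  | West => (0 < x) && dimer d East (x - 1) (n - 1)
  | East => dimer d West x n
  end.
Proof.
rewrite inE; apply/existsP/idP => [[[s q]] /andP[qd]|].
  rewrite endpoints_embed !side_eqE /=.
  by case: s s' qd => [] [] //= qd /andP[/eqP -> /eqP ->];
    rewrite ?subn1 ?dimerE.
case: s' => /=.
- move=> /dimerP[q [qd qx qn]]; exists (South, q).
  by rewrite qd endpoints_embed !side_eqE /= qx qn subn1 prednK // !eqxx.
- case xq': (space_coord q') => [//|x'] /= /dimerP[q [qd qx qn]].
  by exists (North, q); rewrite qd endpoints_embed !side_eqE /= xq' qx qn subn1 !eqxx.
- case xq': (space_coord q') => [//|x'] /= /dimerP[q [qd qx qn]].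
  exists (East, q); rewrite qd endpoints_embed !side_eqE /= xq' qx qn.
  by rewrite !subn1 prednK // !eqxx.
- move=> /dimerP[q [qd qx qn]]; exists (West, q).
  by rewrite qd endpoints_embed !side_eqE /= qx qn !eqxx.
Qed.

Lemma dimer_embed_north x n : dimer (embed d) North x n.+1 = dimer d South x n.
Proof.
case xn: ((x < k.+1) && (n < k.+1)).
  have /andP[xk nk] := xn.
  have [q <- qn] := @square_of k.+1 x n.+1 xk nk.
  by rewrite -qn dimerE mem_embed qn /= subn1.
by rewrite !dimer_ge //; lia.
Qed.

Lemma dimer_embed_south x n :
  dimer (embed d) South x.+1 n = dimer d North x n.
Proof.
case xn: ((x < k) && (0 < n <= k.+1)).
  have /andP[xk nk] := xn.
  have [q qx <-] := @square_of k.+1 x.+1 n xk nk.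
  by rewrite -qx dimerE mem_embed qx /= subn1.
by case: n xn => [|n xn]; rewrite ?dimer0 // !dimer_ge //; lia.
Qed.

Lemma dimer_embed_west x n :
  dimer (embed d) West x.+1 n.+1 = dimer d East x n.
Proof.
case xn: ((x < k) && (n < k.+1)).
  have /andP[xk nk] := xn.
  have [q qx qn] := @square_of k.+1 x.+1 n.+1 xk nk.
  by rewrite -qx -qn dimerE mem_embed qx qn /= !subn1.
by rewrite !dimer_ge //; lia.
Qed.

Lemma dimer_embed_east x n : dimer (embed d) East x n = dimer d West x n.
Proof.
case xn: ((x < k.+1) && (0 < n <= k.+1)).
  have /andP[xk nk] := xn.
  have [q <- <-] := @square_of k.+1 x n xk nk.
  by rewrite dimerE mem_embed /=.
by case: n xn => [|n xn]; rewrite ?dimer0 // !dimer_ge //; lia.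
Qed.

Lemma dimer_embed_south0 n : dimer (embed d) South 0 n = false.
Proof.
by apply/dimerP => -[q [+ qx _]]; rewrite mem_embed qx.
Qed.

Lemma dimer_embed_west0 n : dimer (embed d) West 0 n = false.
Proof.
by apply/dimerP => -[q [+ qx _]]; rewrite mem_embed qx.
Qed.

(** After the removal a square keeps a dimer only if it had exactly one, and sliding is undone by
    applying the involution [opp_side] again. *)
Lemma mem_slid s (q : square k.+1) :
  ((s, q) \in slid d) =
  [forall s', ((s', q) \in embed d) == (s' == opp_side s)].
Proof.
have oppK : involutive opp_side by case.
have -> : ((s, q) \in slid d) = ((opp_side s, q) \in remove_pairs (embed d)).
  apply/imsetP/idP => [[[s' q'] /= + [-> ->]]|]; first by rewrite oppK.
  by move=> qd; exists (opp_side s, q); rewrite // oppK.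
rewrite inE; apply/andP/forallP => [[qd /existsPn sq] s'|sq].
  have [-> | ns] := eqVneq s' (opp_side s); first by rewrite qd.
  have := sq (s', q); rewrite eqxx andbT /= xpair_eqE eqxx andbT ns andbT.
  by move=> /negbTE ->.
split; first by rewrite (eqP (sq _)).
apply/existsPn => -[s' q'] /=.
apply/negP => /and3P[qd /negP ns /eqP qq]; apply: ns.
by move: qd; rewrite qq (eqP (sq s')) => /eqP ->.
Qed.

End Embed.

Definition nb_dimers k (d : {set edge k}) (x n : nat) : nat :=
  dimer d North x n + dimer d South x n + dimer d West x n + dimer d East x n.

(** Applied to the embedded covering, before any removal, this singles out the squares that creation
    fills (see [uncovered_slid]). *)
Definition vacant_at k (d : {set edge k}) (x n : nat) : bool :=
  [&& x < k, 0 < n <= k & nb_dimers d x n == 0].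

Lemma dimer_slid k (d : {set edge k}) s x n :
  dimer (slid d) s x n =
  dimer (embed d) (opp_side s) x n && (nb_dimers (embed d) x n == 1).
Proof.
case xn: ((x < k.+1) && (0 < n <= k.+1)); last first.
  case: n xn => [|n] xn; first by rewrite !dimer0.
  by rewrite !dimer_ge //; lia.
have /andP[xk nk] := xn.
have [q <- <-] := @square_of k.+1 x n xk nk.
rewrite /nb_dimers !dimerE mem_slid.
apply/forallP/idP => [sq|].
  rewrite !(eqP (sq _)) !side_eqE.
  by case: s {sq}.
move=> sq s'; rewrite side_eqE; move: sq.
by case: s s' => [] [] /=; do 4?case: (_ \in embed d).
Qed.

Section Slid.
Variables (k : nat) (d : {set edge k}).
Hypothesis dM : matching d.

Local Notation g := (dimer (embed d)).
Local Notation r := (dimer (slid d)).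
Local Notation vacant := (vacant_at (embed d)).

(** The translation exchanges even and odd vertices, so this is an odd equation of [matching d], and
    [embed_odd] is an even one. The [_first] and [_last] lemmas concern boundary vertices of
    [AG_(k+1)], which no embedded dimer reaches. *)
Lemma embed_even x n : x <= k -> 0 < n <= k ->
  g East x n + g South x n + g North x n.+1 + g West x n.+1 = 1.
Proof.
rewrite dimer_embed_north dimer_embed_east; case: x => [|x] xk nk.
  rewrite dimer_embed_south0 dimer_embed_west0 !addn0 matching_odd0 //.
  by case/andP: nk => /leq_trans H /H ->.
rewrite dimer_embed_south dimer_embed_west -(matching_oddS dM xk nk).
lia.
Qed.

Lemma embed_even_first x : g North x 1 + g West x 1 = 0.
Proof.
rewrite dimer_embed_north dimer0.
by case: x => [|x]; rewrite ?dimer_embed_west0 // dimer_embed_west dimer0.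
Qed.

Lemma embed_even_last x : g East x k.+1 + g South x k.+1 = 0.
Proof.
rewrite dimer_embed_east dimer_ge ?leqnn ?orbT //.
case: x => [|x]; rewrite ?dimer_embed_south0 // dimer_embed_south.
by rewrite dimer_ge ?leqnn ?orbT.
Qed.

Lemma embed_odd x n : x < k -> n <= k ->
  g South x.+1 n.+1 + g West x.+1 n.+1 + g North x n.+1 + g East x n.+1 = 1.
Proof.
move=> xk nk; rewrite -(matching_even dM xk nk).
by rewrite dimer_embed_north dimer_embed_south dimer_embed_west dimer_embed_east; lia.
Qed.

Lemma embed_odd_first n : g South 0 n + g West 0 n = 0.
Proof. by rewrite dimer_embed_south0 dimer_embed_west0. Qed.

Lemma embed_odd_last n : g North k n + g East k n = 0.
Proof.
rewrite dimer_embed_east (@dimer_ge _ _ West) ?leqnn //.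
by case: n => [|n]; rewrite ?dimer0 // dimer_embed_north dimer_ge ?leqnn.
Qed.

(** Each sum is the contribution of one square to the covering equation at one of its corners. Hence
    two dimers on a square are opposite sides. *)
Lemma embed_square x n : x <= k -> n <= k ->
  [/\ g South x n.+1 + g East x n.+1 <= 1, g North x n.+1 + g West x n.+1 <= 1,
      g South x n.+1 + g West x n.+1 <= 1 & g North x n.+1 + g East x n.+1 <= 1].
Proof.
move=> xk nk; split.
- move: nk; rewrite leq_eqVlt => /predU1P[->|nk].
    by have := embed_even_last x; lia.
  by have := @embed_even x n.+1 xk nk; lia.
- case: n nk => [|n] nk; first by have := embed_even_first x; lia.
  by have := @embed_even x n.+1 xk nk; lia.
- case: x xk => [|x] xk; first by have := embed_odd_first n.+1; lia.
  by have := @embed_odd x n xk nk; lia.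
- move: xk; rewrite leq_eqVlt => /predU1P[->|xk].
    by have := embed_odd_last n.+1; lia.
  by have := @embed_odd x n xk nk; lia.
Qed.

(** A square meets each of its corners either before the step or after it, never both: without
    dimers it gets filled, a single dimer moves to the two other corners, and a pair, which met all
    four, disappears. *)
Lemma slid_square x n : x <= k -> n <= k ->
  [/\ r South x n.+1 + r East x n.+1 + vacant x n.+1
        + (g South x n.+1 + g East x n.+1) = 1,
      r North x n.+1 + r West x n.+1 + vacant x n.+1
        + (g North x n.+1 + g West x n.+1) = 1,
      r South x n.+1 + r West x n.+1 + vacant x n.+1
        + (g South x n.+1 + g West x n.+1) = 1 &
      r North x n.+1 + r East x n.+1 + vacant x n.+1
        + (g North x n.+1 + g East x n.+1) = 1].
Proof.
move=> xk nk; have [] := embed_square xk nk.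
rewrite !dimer_slid /= /vacant_at /nb_dimers !ltnS xk nk /=.
by do 4!case: (dimer _ _ _ _).
Qed.

Lemma vac_ge x n : (k < x) || (k.+1 < n) -> vacant x n = false.
Proof. by rewrite /vacant_at; lia. Qed.

Lemma vac0 x : vacant x 0 = false.
Proof. by rewrite /vacant_at andbF. Qed.

(** Sum [slid_square] over the squares around the vertex: an interior vertex lies on two squares and
    was covered once, a boundary vertex lies on one and was not covered. Both cases leave one. *)
Lemma slid_even x n : x <= k -> n <= k.+1 ->
  (r South x n + r East x n + vacant x n)
    + (r North x n.+1 + r West x n.+1 + vacant x n.+1) = 1.
Proof.
move=> xk nk; case: n nk => [|n] nk.
  rewrite !dimer0 vac0; have [_ + _ _] := @slid_square x 0 xk isT.
  by have := embed_even_first x; lia.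
have [+ _ _ _] := @slid_square x n xk nk.
move: nk; rewrite ltnS leq_eqVlt => /predU1P[->|nk].
   by rewrite (@vac_ge x k.+2) ?ltnSn ?orbT // !(@dimer_ge _ _ _ x k.+2) ?ltnSn ?orbT //;
    have := embed_even_last x; lia.
have [_ + _ _] := @slid_square x n.+1 xk nk.
by have := @embed_even x n.+1 xk nk; lia.
Qed.

Lemma slid_odd0 n : 0 < n <= k.+1 ->
  r West 0 n + r South 0 n + vacant 0 n = 1.
Proof.
case: n => // n nk; have [_ _ + _] := @slid_square 0 n (leq0n k) nk.
by have := embed_odd_first n.+1; lia.
Qed.

Lemma slid_oddS x n : x <= k -> 0 < n <= k.+1 ->
  (r West x.+1 n + r South x.+1 n + vacant x.+1 n)
    + (r North x n + r East x n + vacant x n) = 1.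
Proof.
move=> + nk; case: n nk => // n nk; rewrite leq_eqVlt => /predU1P[->|xk].
  rewrite (@vac_ge k.+1) ?ltnSn // !(@dimer_ge _ _ _ k.+1) ?leqnn //.
  have [_ _ _ +] := @slid_square k n (leqnn k) nk.
  by have := embed_odd_last n.+1; lia.
have [_ _ _ +] := @slid_square x n (ltnW xk) nk.
have [_ _ + _] := @slid_square x.+1 n xk nk.
by have := @embed_odd x n xk nk; lia.
Qed.

End Slid.

(** * Vertices, coverage and uniqueness of the family of uncovered squares *)

Definition even_vertex (x n : nat) : vertex := (x%:Z + n%:Z, x%:Z - n%:Z)%R.
Definition odd_vertex (x n : nat) : vertex := (x%:Z + n%:Z - 1, x%:Z - n%:Z)%R.

(** [even_vertex x n] is the south-east corner of the square [(x, n)] and the north-west corner of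
    [(x, n.+1)]; [odd_vertex x n] is the south-west corner of [(x, n)] and the north-east corner of
    [(x - 1, n)]. *)
Lemma mem_corners_even k (q : square k) x n :
  (even_vertex x n \in corners q) =
  (space_coord q == x) && ((level q == n) || (level q == n.+1)).
Proof.
rewrite /corners /sw_corner !inE /even_vertex !xpair_eqE.
have : 0 < level q by [].
move: (space_coord q) (level q) => y m; lia.
Qed.

Lemma mem_corners_odd k (q : square k) x n :
  (odd_vertex x n \in corners q) =
  (level q == n) && ((space_coord q == x) || ((space_coord q).+1 == x)).
Proof.
rewrite /corners /sw_corner !inE /odd_vertex !xpair_eqE.
move: (space_coord q) (level q) => y m; lia.
Qed.

Lemma corners_even_odd k (q : square k) v : v \in corners q ->
  (exists x n, [/\ x < k, n <= k & v = even_vertex x n]) \/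
  (exists x n, [/\ x <= k, 0 < n <= k & v = odd_vertex x n]).
Proof.
rewrite /corners /sw_corner !inE.
have qx : space_coord q < k by exact: ltn_ord.
have qn : 0 < level q <= k by exact: ltn_ord.
move: (space_coord q) (level q) qx qn => x n qx qn.
case/or4P => /eqP ->; [right|left|left|right].
- by exists x, n; split=> //; lia.
- by exists x, n; split; rewrite /even_vertex; [lia..|congr (_, _); lia].
- by exists x, (n - 1); split; rewrite /even_vertex; [lia..|congr (_, _); lia].
- by exists x.+1, n; split; rewrite /odd_vertex; [lia..|congr (_, _); lia].
Qed.

Lemma mem_vertices k v :
  reflect (exists q : square k, v \in corners q) (v \in vertices k).
Proof.
rewrite mem_undup; apply: (iffP flatten_mapP) => [[q _ qv]|[q qv]].
  by exists q.
by exists q; rewrite ?mem_enum.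
Qed.

Lemma covered_even k (d : {set edge k}) x n :
  covered d (even_vertex x n) =
  [|| dimer d South x n, dimer d East x n, dimer d West x n.+1
    | dimer d North x n.+1].
Proof.
have inc (e : edge k) : (even_vertex x n == (endpoints e).1)
    || (even_vertex x n == (endpoints e).2) =
  (space_coord e.2 == x) && (level e.2 ==
     if (e.1 == South) || (e.1 == East) then n else n.+1).
  case: e => s q; rewrite /endpoints /sw_corner /even_vertex !side_eqE.
  move: (space_coord q) (level q) => y m.
  by case: s; rewrite /= !xpair_eqE; lia.
apply/existsP/or4P => [[[s q]] /andP[qd]|].
  rewrite inc /= => /andP[/eqP <-]; rewrite !side_eqE.
  by case: s qd => qd /eqP nq; [apply: Or44|apply: Or41|apply: Or43|apply: Or42];
    rewrite -nq dimerE.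
by case=> /dimerP[q [qd qx qn]]; eexists; apply/andP; (split; first exact: qd);
  rewrite inc /= !side_eqE qx qn !eqxx.
Qed.

Lemma covered_odd k (d : {set edge k}) x n :
  covered d (odd_vertex x n) =
  [|| dimer d West x n, dimer d South x n,
      (0 < x) && dimer d North (x - 1) n | (0 < x) && dimer d East (x - 1) n].
Proof.
have inc (e : edge k) : (odd_vertex x n == (endpoints e).1)
    || (odd_vertex x n == (endpoints e).2) =
  (level e.2 == n) && ((if (e.1 == South) || (e.1 == West)
     then space_coord e.2 else (space_coord e.2).+1) == x).
  case: e => s q; rewrite /endpoints /sw_corner /odd_vertex !side_eqE.
  move: (space_coord q) (level q) => y m.
  by case: s; rewrite /= !xpair_eqE; lia.
apply/existsP/or4P => [[[s q]] /andP[qd]|].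
  rewrite inc /= => /andP[/eqP <-]; rewrite !side_eqE.
  by case: s qd => qd /eqP nq; [apply: Or43|apply: Or42|apply: Or41|apply: Or44];
    rewrite -nq /= ?subn1 dimerE.
case=> [|||]; last 2 first.
- case: x inc => // x inc /dimerP[q [qd qx qn]]; exists (North, q).
  by rewrite qd inc /= !side_eqE qx qn subn1 !eqxx.
- case: x inc => // x inc /dimerP[q [qd qx qn]]; exists (East, q).
  by rewrite qd inc /= !side_eqE qx qn subn1 !eqxx.
- move=> /dimerP[q [qd qx qn]]; exists (West, q).
  by rewrite qd inc /= !side_eqE qx qn !eqxx.
- move=> /dimerP[q [qd qx qn]]; exists (South, q).
  by rewrite qd inc /= !side_eqE qx qn !eqxx.
Qed.

(* Working up in [n], the square [(x, n.+1)] is selected iff the vertex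
   [even_vertex x n] is uncovered and [(x, n)] is not selected. *)
Lemma tiles_uncovered_uniq k (d : {set edge k}) (F F' : {set square k}) :
  tiles_uncovered d F -> tiles_uncovered d F' -> F = F'.
Proof.
have step G (q : square k) : tiles_uncovered d G ->
    (q \in G) = ~~ covered d (even_vertex (space_coord q) (level q - 1)) &&
      ~~ [exists q' in G, (space_coord q' == space_coord q)
                            && (level q' == (level q - 1))].
  move=> /andP[/forallP disj /allP cov].
  set v := even_vertex _ _.
  have qv : v \in corners q.
    by rewrite mem_corners_even eqxx; have : 0 < level q by []; lia.
  have vV : v \in vertices k by apply/mem_vertices; exists q.
  rewrite (eqP (cov v vV)).
  apply/idP/andP => [qG|[/existsP[q' /andP[q'G]]]].
    split; first by apply/existsP; exists q; rewrite qG.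
    apply/negP => /existsP[q' /and3P[q'G /eqP xq' /eqP nq']].
    have /implyP/(_ qG)/forallP/(_ q')/implyP/(_ q'G)/implyP := disj q.
    case: eqP => [qq'|_ /(_ isT)/hasPn/(_ _ qv)].
      by move: nq'; rewrite -qq'; have : 0 < level q by []; lia.
    by rewrite inE mem_corners_even xq' nq' !eqxx.
  rewrite mem_corners_even subn1 prednK // -subn1 => /andP[/eqP xq'].
  move=> /orP[nq' /negP[]|/eqP nq' _].
    by apply/existsP; exists q'; rewrite q'G xq' eqxx.
  by rewrite -(square_inj xq' nq').
move=> FP FP'; apply/setP => q.
have [n qn] := ubnP (level q).
elim: n => // n IH in q qn *; rewrite !step //; congr (_ && ~~ _).
apply: eq_existsb => q' /=.
case q'P: (_ && (level q' == _)); last by rewrite !andbF.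
case/andP: q'P => _ /eqP q'n; rewrite IH // q'n.
by move: qn; have : 0 < level q by []; lia.
Qed.

(** * Creation *)

Definition vacant_squares k (d : {set edge k}) : {set square k.+1} :=
  [set q | vacant_at (embed d) (space_coord q) (level q)].

Section Create.
Variables (k : nat) (d : {set edge k}).
Hypothesis dM : matching d.

Local Notation r := (dimer (slid d)).
Local Notation vacant := (vacant_at (embed d)).

Lemma vac_square x n : vacant x n ->
  exists q, [/\ q \in vacant_squares d, space_coord q = x & level q = n].
Proof.
move=> V; have /and3P[xk nk _] := V.
by have [q xq nq] := square_of xk nk; exists q; rewrite inE xq nq.
Qed.

(** By [slid_even], [slid_odd0] and [slid_oddS] each vertex meets either one slid dimer or one
    vacant square, and only one. This gives both disjointness and the description of the uncovered
    vertices. *)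
Lemma tiles_vacant_squares : tiles_uncovered (slid d) (vacant_squares d).
Proof.
apply/andP; split.
  apply/forallP => q; apply/implyP => qV.
  apply/forallP => q'; apply/implyP => q'V.
  apply/implyP => qq'; apply/hasPn => v qv; apply/negP => /= q'v.
  move: qV q'V; rewrite !inE.
  case: (corners_even_odd qv) => -[x [n [xk nk ve]]]; subst v.
    have := slid_even dM xk nk.
    move: qv q'v; rewrite !mem_corners_even.
    move=> /andP[/eqP xq nq] /andP[/eqP xq' nq'].
    case: nq nq' => /orP[/eqP nq|/eqP nq] /orP[/eqP nq'|/eqP nq'].
    - by case/negP: qq'; apply/eqP/square_inj; lia.
    - by rewrite xq nq xq' nq'; lia.
    - by rewrite xq nq xq' nq'; lia.
    - by case/negP: qq'; apply/eqP/square_inj; lia.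
  move: qv q'v; rewrite !mem_corners_odd.
  move=> /andP[/eqP nq xq] /andP[/eqP nq' xq']; rewrite nq nq'.
  case: xq xq' => /orP[/eqP xq|/eqP xq] /orP[/eqP xq'|/eqP xq'].
  - by case/negP: qq'; apply/eqP/square_inj; lia.
  - move: xk; rewrite -xq' in xq *; rewrite xq => xk.
    by have := slid_oddS dM xk nk; lia.
  - move: xk; rewrite -xq in xq' *; rewrite xq' => xk.
    by have := slid_oddS dM xk nk; lia.
  - by case/negP: qq'; apply/eqP/square_inj; lia.
apply/allP => v /mem_vertices[q qv].
case: (corners_even_odd qv) => -[x [n [xk nk ->]]].
  rewrite covered_even.
  have -> : [exists q in vacant_squares d, even_vertex x n \in corners q]
      = vacant x n || vacant x n.+1.
    apply/existsP/orP => [[q' /andP[]]|].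
      rewrite inE mem_corners_even => + /andP[/eqP xq' nq'].
      by rewrite xq'; case/orP: nq' => /eqP ->; [left|right].
    by case=> /vac_square[q' [q'V xq' nq']]; exists q';
      rewrite q'V mem_corners_even xq' nq' !eqxx ?orbT.
  by have := slid_even dM xk nk; do 4!case: (r _ _ _); do 2!case: vacant_at.
rewrite covered_odd.
have -> : [exists q in vacant_squares d, odd_vertex x n \in corners q]
    = vacant x n || (0 < x) && vacant (x - 1) n.
  apply/existsP/orP => [[q' /andP[]]|].
    rewrite inE mem_corners_odd => + /andP[/eqP nq' xq'].
    by rewrite nq'; case/orP: xq' => /eqP <-; [left|right; rewrite subn1].
  case=> [|/andP[x0]] /vac_square[q' [q'V xq' nq']]; exists q';
    rewrite q'V mem_corners_odd xq' nq' ?subn1 ?prednK // !eqxx ?orbT //.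
case: x xk => [|x] xk.
  by have := slid_odd0 dM nk; do 2!case: (r _ _ _); case: vacant_at.
rewrite subn1 /=; have := slid_oddS dM xk nk.
by do 4!case: (r _ _ _); do 2!case: vacant_at.
Qed.

(** The family returned by [pick] is arbitrary, but [tiles_uncovered_uniq] leaves only one
    candidate. *)
Lemma uncovered_slid : uncovered_squares (slid d) = vacant_squares d.
Proof.
rewrite /uncovered_squares; case: pickP => [F /= FP|/(_ (vacant_squares d))].
  exact: tiles_uncovered_uniq FP tiles_vacant_squares.
by rewrite tiles_vacant_squares.
Qed.

Section Tiling.
Variable A : {set square k.+1}.
Hypothesis AV : A \subset vacant_squares d.

Local Notation c := (create (slid d) A).

Lemma mem_create (s : side) (q : square k.+1) : ((s, q) \in c) = ((s, q) \in slid d) ||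
  (q \in vacant_squares d) && ((q \in A) == ((s == West) || (s == East))).
Proof.
rewrite /create uncovered_slid !inE -orbA; congr (_ || _).
have we q' : ((s, q) \in we_pair q') =
    (q == q') && ((s == West) || (s == East)).
  by rewrite !inE !xpair_eqE; case: (q == q'); rewrite ?andbT ?andbF.
have ns q' : ((s, q) \in ns_pair q') =
    (q == q') && ((s == North) || (s == South)).
  by rewrite !inE !xpair_eqE; case: (q == q'); rewrite ?andbT ?andbF.
have -> : ((s, q) \in \bigcup_(q' in A) we_pair q') =
    (q \in A) && ((s == West) || (s == East)).
  apply/bigcupP/andP => [[q' q'A]|[qA sE]]; last by exists q; rewrite // we eqxx.
  by rewrite we => /andP[/eqP -> ->].
have -> : ((s, q) \in \bigcup_(q' in vacant_squares d :\: A) ns_pair q') =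
    (q \in vacant_squares d :\: A) && ((s == North) || (s == South)).
  apply/bigcupP/andP => [[q' q'A]|[qA sE]]; last by exists q; rewrite // ns eqxx.
  by rewrite ns => /andP[/eqP -> ->].
rewrite in_setD; have := subsetP AV q.
have -> : vacant (space_coord q) (level q) = (q \in vacant_squares d).
  by rewrite inE.
rewrite !side_eqE; case: (q \in A) => [/(_ isT) ->|_].
  by case: s {we ns}.
by case: (q \in vacant_squares d); case: s {we ns}.
Qed.

(** Whichever pair fills a vacant square, each corner meets exactly one of its two dimers; so the
    counts do not depend on [A]. *)
Lemma create_square x n :
  [/\ dimer c South x n + dimer c East x n =
        r South x n + r East x n + vacant x n,
      dimer c North x n + dimer c West x n =
        r North x n + r West x n + vacant x n,
      dimer c South x n + dimer c West x n =
        r South x n + r West x n + vacant x n &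
      dimer c North x n + dimer c East x n =
        r North x n + r East x n + vacant x n].
Proof.
case xn: ((x < k.+1) && (0 < n <= k.+1)); last first.
  have -> : vacant x n = false by rewrite /vacant_at andbA xn.
  case: n xn => [|n] xn; first by rewrite !dimer0.
  by rewrite !dimer_ge //; lia.
have /andP[xk nk] := xn.
have [q xq nq] := @square_of k.+1 x n xk nk.
have rV s : r s x n -> vacant x n = false.
  by rewrite dimer_slid /vacant_at => /andP[_ /eqP ->]; rewrite !andbF.
have cE s : dimer c s x n =
    r s x n || vacant x n && ((q \in A) == ((s == West) || (s == East))).
  by rewrite -xq -nq !dimerE mem_create inE.
rewrite !cE !side_eqE.
have := (rV North, rV South, rV West, rV East).
case: (vacant x n); last by rewrite !orbF !addn0.
case: (r North x n) => [[[[/(_ isT)]]]//|].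
case: (r South x n) => [[[[_ /(_ isT)]]]//|].
case: (r West x n) => [[[_ /(_ isT)]]//|].
case: (r East x n) => [[_ /(_ isT)]//|] _.
by case: (q \in A).
Qed.

Lemma matching_create : matching c.
Proof.
split=> [x n xk nk|n nk|x n xk nk].
- have [E1 _ _ _] := create_square x n.
  have [_ E2 _ _] := create_square x n.+1.
  by rewrite -addnA [_ + dimer _ North _ _]addnC E1 E2; apply: slid_even.
- have [_ _ E1 _] := create_square 0 n.
  by rewrite addnC E1 [r South _ _ + _]addnC; apply: slid_odd0.
- have [_ _ E1 _] := create_square x.+1 n.
  have [_ _ _ E2] := create_square x n.
  rewrite -addnA [dimer _ West _ _ + _]addnC E1 E2 [r South _ _ + _]addnC.
  exact: slid_oddS.
Qed.

End Tiling.
End Create.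

(** * Particles *)

Section FilterIota.
Variables (P : pred nat) (k : nat).
Local Notation s := [seq x <- iota 0 k | P x].
Local Notation below x := (count P (iota 0 x)).

Lemma count_iotaS x : below x.+1 = below x + P x.
Proof. by rewrite -addn1 iotaD count_cat /= addn0. Qed.

Lemma filter_iota_split x : x <= k ->
  s = [seq y <- iota 0 x | P y] ++ [seq y <- iota x (k - x) | P y].
Proof. by move=> xk; rewrite -filter_cat -[x in iota x _]add0n -iotaD subnKC. Qed.

Lemma nth_filter_iota_count x : x < k -> P x -> nth 0 s (below x) = x.
Proof.
move=> xk Px; rewrite (filter_iota_split (ltnW xk)) nth_cat size_filter.
rewrite ltnn subnn; have -> : k - x = (k - x.+1).+1 by lia.
by rewrite /= Px.
Qed.

Lemma count_lt_size_filter_iota x : x < k -> P x -> below x < size s.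
Proof.
move=> xk Px; rewrite (filter_iota_split (ltnW xk)) size_cat size_filter.
have -> : k - x = (k - x.+1).+1 by lia.
by rewrite /= Px /= -addSnnS leq_addr.
Qed.

(** Adjunction between the enumeration of the selected numbers and their counting function. *)
Lemma nth_filter_iota_lt i x : i < size s -> x <= k ->
  (nth 0 s i < x) = (i < below x).
Proof.
move=> + xk; rewrite (filter_iota_split xk) nth_cat size_cat -size_filter => ik.
case: (ltnP i) => ix.
  by have := mem_nth 0 ix; rewrite mem_filter mem_iota => /and3P[].
have : i - size [seq y <- iota 0 x | P y] < size [seq y <- iota x (k - x) | P y].
  by rewrite ltn_subLR.
move=> /(mem_nth 0); rewrite mem_filter mem_iota => /and3P[_ + _].
by rewrite leqNgt => /negbTE.
Qed.

Lemma nth_filter_iotaP i : i < size s ->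
  [/\ nth 0 s i < k, P (nth 0 s i) & below (nth 0 s i) = i].
Proof.
move=> ik; set x := nth 0 s i.
have /[!mem_filter] /andP[Px] := mem_nth 0 ik.
rewrite mem_iota add0n -/x => /= xk; split=> //.
have := nth_filter_iota_lt ik (ltnW xk); rewrite -/x ltnn.
by have := nth_filter_iota_lt ik xk; rewrite -/x ltnSn count_iotaS Px; lia.
Qed.

End FilterIota.

Definition has_particle k (d : {set edge k}) (n x : nat) : bool :=
  dimer d South x n || dimer d East x n.

Lemma particlesE k (d : {set edge k}) n :
  particles d n = [seq x <- iota 0 k | has_particle d n x].
Proof.
apply: eq_filter => x; apply/existsP/orP => [[q /and3P[/eqP <- /eqP <-]]|].
  by rewrite -!dimerE => /orP.
by case=> /dimerP[q [qd <- <-]]; exists q; rewrite qd !eqxx ?orbT.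
Qed.

Notation nb_below d n x := (count (has_particle d n) (iota 0 x)).

Section Particles.
Variables (k : nat) (d : {set edge k}).
Hypothesis dM : matching d.

Lemma partE n x : n <= k -> has_particle d n x = dimer d South x n + dimer d East x n :> nat.
Proof.
move=> nk; rewrite /has_particle; have [xk|xk] := ltnP x k.
  by have := matching_even dM xk nk; do 2!case: (dimer _ _ _ _).
by rewrite !dimer_ge ?xk.
Qed.

Lemma hole_part n x : x < k -> n < k ->
  has_particle d n x + dimer d West x n.+1 + dimer d North x n.+1 = 1.
Proof. by move=> xk nk; rewrite partE 1?ltnW // (matching_even dM) // ltnW. Qed.

(* The particles of level [n.+1] and the holes of level [n] at positions [<= x] are
   matched with the [x.+1] leftmost odd vertices of level [n.+1], plus the next one
   if the square [(x, n.+1)] has a North or East dimer. *)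
Lemma nb_belowS n x : x < k -> n < k ->
  nb_below d n.+1 x.+1 =
  nb_below d n x.+1 + dimer d North x n.+1 + dimer d East x n.+1.
Proof.
elim: x => [|x IH] xk nk.
  rewrite /= !addn0 partE //.
  have := hole_part xk nk; have := @matching_odd0 _ _ dM n.+1 nk.
  by lia.
rewrite !(count_iotaS _ x.+1) (IH (ltnW xk) nk) partE //.
have := hole_part xk nk; have := @matching_oddS _ _ dM x n.+1 (ltnW xk) nk.
by lia.
Qed.

Lemma size_particles n : n <= k -> size (particles d n) = n.
Proof.
move=> nk; rewrite particlesE size_filter; elim: n nk => [|n IH] nk.
  by rewrite (eq_count (a2 := pred0)) ?count_pred0 // => x; rewrite /has_particle !dimer0.
have k0 : 0 < k by lia.
have nb := @nb_belowS n k.-1; rewrite prednK // IH ?(ltnW nk) // in nb.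
(* The odd vertex [(k, n.+1)] at the right end has no West or South dimer, so the correction term of
   [nb_belowS] is one at the last position. *)
rewrite nb ?leqnn //; have := @matching_oddS _ _ dM k.-1 n.+1.
by rewrite prednK // (@dimer_ge _ _ West) ?leqnn // (@dimer_ge _ _ South)
  ?leqnn //; lia.
Qed.

Lemma particleP n i : 0 < i <= n -> n <= k ->
  let x := particle d n i in
  [/\ x < k, has_particle d n x & nb_below d n x = i.-1].
Proof.
move=> /andP[i0 ni] nk /=; rewrite /particle particlesE.
by apply: nth_filter_iotaP; rewrite -particlesE size_particles //; lia.
Qed.

Lemma particle_lt n i x : 0 < i <= n -> n <= k -> x <= k ->
  (particle d n i < x) = (i <= nb_below d n x).
Proof.
move=> /andP[i0 ni] nk xk; rewrite /particle particlesE.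
rewrite nth_filter_iota_lt ?prednK // -particlesE size_particles //; lia.
Qed.

Lemma particleE n i x : 0 < i -> x < k -> has_particle d n x ->
  nb_below d n x = i.-1 -> particle d n i = x.
Proof.
by move=> i0 xk px xi; rewrite /particle particlesE -xi nth_filter_iota_count.
Qed.

End Particles.

(* [x] is the position of particle [i] of level [n], [u] and [v] are the new
   positions of particles [i] and [i - 1] of level [n - 1], and [b] is the coin.
   [u] is ignored for [i = n] and [v] for [i = 1], where Y uses +oo and -oo. *)
Definition push_step (n i x u v : nat) (b : bool) : nat :=
  let m := maxn (x + b) (if i == 1 then 0 else v.+1) in
  if i == n then m else minn u m.

(* The coin matters only if level [n - 1] has a hole at [x]; otherwise the particle
   of level [n - 1] at [x] has index [i], and blocks, or [i - 1], and pushes. *)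
Lemma push_step_particle k (d : {set edge k}) n i b : matching d ->
  0 < i <= n -> n <= k ->
  let x := particle d n i in
  (has_particle d n.-1 x = false -> b = dimer d East x n) ->
  push_step n i x (particle d n.-1 i) (particle d n.-1 i.-1) b =
    x + dimer d East x n.
Proof.
move=> dM /andP[i0 ni] nk x hole.
case: n ni nk @x hole => [|n] ni nk /=; first by lia.
set x := particle d n.+1 i => hole.
have [xk px nbx] : [/\ x < k, has_particle d n.+1 x & nb_below d n.+1 x = i.-1].
  by apply: particleP; rewrite ?i0.
have nb := nb_belowS dM xk nk; rewrite !count_iotaS px nbx in nb.
have hp := hole_part dM xk nk; have pE := partE dM x nk; rewrite px in pE.
have u_gt : i <= n -> nb_below d n x.+1 = i.-1 -> x < particle d n i.
  by move=> ni' nbn; rewrite ltnNge -ltnS particle_lt ?i0 ?(ltnW nk) // nbn; lia.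
have v_lt : 1 < i -> nb_below d n x = i.-1 -> particle d n i.-1 < x.
  move=> i1 nbn; rewrite particle_lt ?nbn ?(ltnW nk) ?(ltnW xk) //; lia.
rewrite count_iotaS in u_gt; rewrite /push_step.
have NE : dimer d North x n.+1 + dimer d East x n.+1 <= 1.
  by have := @matching_oddS _ _ dM x n.+1 xk nk; clear; lia.
have SW : dimer d South x n.+1 + dimer d West x n.+1 <= 1.
  case: (x) xk => [|y] yk.
    by have := @matching_odd0 _ _ dM n.+1 nk; clear; lia.
  by have := @matching_oddS _ _ dM y n.+1 (ltnW yk) nk; clear; lia.
(* With an East dimer, [nb] leaves [i - 1] particles of level [n] at positions up to and including
   [x]: one sitting at [x] has index [i - 1] and pushes. *)
have [E|E] := boolP (dimer d East x n.+1).
  have nbn : nb_below d n x + has_particle d n x = i.-1 by lia.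
  have v_eq : has_particle d n x -> 1 < i /\ particle d n i.-1 = x.
    move=> p; split; first by lia.
    by rewrite (@particleE _ _ n _ x) //; lia.
  case: (boolP (has_particle d n x)) v_eq nbn hole => p.
    move=> /(_ isT)[i1 ->] nbn _; rewrite [i == 1]gtn_eqF //.
    have -> : maxn (x + b) x.+1 = x.+1 by lia.
    rewrite addn1; case: eqP => // /eqP ni'.
    by apply/minn_idPr/u_gt; lia.
  move=> _ nbn /(_ erefl) ->; rewrite E.
  have -> : maxn (x + 1) (if i == 1 then 0 else (particle d n i.-1).+1) = x + 1.
    by case: eqP => // /eqP i1; have := v_lt; lia.
  case: eqP => // /eqP ni'; apply/minn_idPr; rewrite addn1.
  by apply: u_gt; lia.
(* Without it the particle comes from a South dimer, which excludes West. Then [i - 1] particles of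
   level [n] are strictly left of [x], and one at [x] has index [i] and blocks. *)
have nbn : nb_below d n x = i.-1 by lia.
have v_le : (if i == 1 then 0 else (particle d n i.-1).+1) <= x.
  by case: eqP => // /eqP i1; apply: v_lt; lia.
rewrite addn0; have [p|p] := boolP (has_particle d n x).
  have : nb_below d n x < n.
    rewrite -[leqRHS](size_particles dM (ltnW nk)) particlesE.
    exact: count_lt_size_filter_iota.
  by rewrite nbn (particleE i0 xk p nbn); case: eqP; lia.
rewrite hole ?(negbTE E) ?(negbTE p) // addn0 (maxn_idPl v_le).
case: eqP => // /eqP ni'; apply/minn_idPr/ltnW/u_gt; lia.
Qed.

Section NextParticles.
Variables (k : nat) (d : {set edge k}) (A : {set square k.+1}).
Hypothesis dM : matching d.
Hypothesis AV : A \subset vacant_squares d.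

Local Notation c := (create (slid d) A).

(** At the even vertex [(x, n)] the new dimer is in level [n] iff the embedded one was a North or
    West side of [(x, n.+1)], that is, an old South dimer at [x] or an old East dimer at [x - 1]. *)
Lemma part_create n x : x <= k -> 0 < n <= k ->
  has_particle c n x = dimer d South x n + (0 < x) * dimer d East (x - 1) n :> nat.
Proof.
move=> xk nk; case: n nk => // n nk.
rewrite (partE (matching_create dM AV)); last by lia.
have [-> _ _ _] := create_square dM AV x n.+1.
have [+ _ _ _] := slid_square dM xk (ltnW nk).
have := @embed_even _ _ dM x n.+1 xk nk.
rewrite dimer_embed_north.
case: x xk => [|x] xk; first by rewrite dimer_embed_west0; lia.
by rewrite dimer_embed_west subn1 mul1n /=; lia.
Qed.

Lemma part_create_last x : x <= k -> has_particle c k.+1 x.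
Proof.
move=> xk; have := matching_even (matching_create dM AV) xk (leqnn _).
have := partE (matching_create dM AV) x (leqnn _).
rewrite (@dimer_ge _ _ West) ?ltnSn ?orbT // (@dimer_ge _ _ North) ?ltnSn ?orbT //.
by case: has_particle; lia.
Qed.

(** Particles left of [x] move by at most one and stay in the count; one at [x] stays in it only if
    it does not move. *)
Lemma nb_below_create n x : x <= k -> 0 < n <= k ->
  nb_below c n x.+1 = nb_below d n x + dimer d South x n.
Proof.
move=> + nk; have /andP[_ nk'] := nk; elim: x => [|x IH] xk.
  by rewrite /= addn0 part_create // ltnn mul0n addn0.
rewrite count_iotaS IH ?(ltnW xk) // count_iotaS part_create //.
by rewrite (partE dM _ nk') subn1 mul1n /=; lia.
Qed.

Lemma particle_create n i : 0 < i <= n -> n <= k ->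
  particle c n i =
    particle d n i + dimer d East (particle d n i) n.
Proof.
move=> ni nk; have [xk px nbx] := particleP dM ni nk.
move: (particle d n i) xk px nbx => x xk px nbx.
have n0 : 0 < n <= k by lia.
have pE := partE dM x nk; rewrite px in pE.
have o := matching_oddS dM xk n0.
have i0 : 0 < i by lia.
case: (boolP (dimer d East x n)) pE o => E /= pE o.
  rewrite addn1; apply: particleE => //.
    by have := part_create xk n0; rewrite subn1 /= E; case: has_particle; lia.
  by rewrite nb_below_create ?(ltnW xk) //; lia.
rewrite addn0; apply: particleE => //; first exact: ltnW.
  by have := part_create (ltnW xk) n0; case: has_particle; lia.
(* The South dimer at [x.+1] shares an odd vertex with the East side at [x], so no particle moves
   from [x] onto [x.+1]. *)
case: x xk px nbx E pE o => [|x] xk px nbx E pE o; first by [].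
rewrite nb_below_create // ?(ltnW (ltnW xk)) // -nbx count_iotaS.
have S1 : dimer d South x.+1 n by move: pE; case: dimer.
have := partE dM x nk; have := matching_oddS dM (ltnW xk) n0.
by rewrite S1; clear; lia.
Qed.

Lemma particle_create_last i : 0 < i <= k.+1 -> particle c k.+1 i = i.-1.
Proof.
move=> ik; have all_part : all (has_particle c k.+1) (iota 0 k.+1).
  by apply/allP => x; rewrite mem_iota => /andP[_ xk]; apply: part_create_last.
rewrite /particle particlesE (all_filterP all_part) nth_iota //; lia.
Qed.

(* Two dimers on one square can only come from creation: a square is left with at
   most one slid dimer. *)
Lemma create_pair x n : x <= k -> 0 < n <= k.+1 ->
  has_particle c n x -> has_particle c n.-1 x = false -> vacant_at (embed d) x n.
Proof.
case: n => // n xk nk px hx; have cM := matching_create dM AV.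
have := hole_part cM xk nk; rewrite -[n in has_particle _ n]/(n.+1.-1) hx add0n addnC.
have := partE cM x nk; rewrite px.
have [-> -> _ _] := create_square dM AV x n.+1.
rewrite !dimer_slid /nb_dimers; case: vacant_at => //.
by do 4!case: (dimer _ _ _ _).
Qed.

Lemma create_east q : q \in vacant_squares d ->
  dimer c East (space_coord q) (level q) = (q \in A).
Proof.
move=> qV; rewrite dimerE mem_create // qV !side_eqE -dimerE dimer_slid.
move: qV; rewrite inE => /and3P[_ _ /eqP ->].
by rewrite andbF; case: (q \in A).
Qed.

(** Both kinds of pair contain a South or East side, so every coin of the step belongs to some
    particle. *)
Lemma part_vacant q : q \in vacant_squares d ->
  has_particle c (level q) (space_coord q).
Proof.
move=> qV; rewrite /has_particle !dimerE !mem_create // qV !side_eqE.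
by case: (q \in A); rewrite !orbT.
Qed.

End NextParticles.

(** * Transition probabilities *)

(** The expectation of a product of functions of independent coins on [U] factorises. Indices [t]
    are particles and [g t] their squares; outside [U] the weights sum to one and [f t] ignores the
    coin. *)
Lemma sum_subsets_prod (R : comNzRingType) (S T : finType) (g : T -> S)
    (U : {set S}) (p : S -> R) (f : T -> bool -> R) : injective g ->
  (forall q, q \in U -> exists t, g t = q) ->
  (forall t, g t \notin U -> f t true = f t false) ->
  (\sum_(A : {set S} | A \subset U)
     (\prod_(q in A) p q * \prod_(q in U :\: A) (1 - p q)) *
     \prod_t f t (g t \in A) =
   \prod_t (p (g t) * f t true + (1 - p (g t)) * f t false))%R.
Proof.
move=> g_inj gU fU.
(* [h] carries [f] over to squares, with the neutral value 1 where there is no particle. *)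
pose h q b : R := if [pick t | g t == q] is Some t then f t b else 1%R.
have hg t b : h (g t) b = f t b.
  rewrite /h; case: pickP => [t' /eqP/g_inj ->//|/(_ t)].
  by rewrite eqxx.
have h1 q b : q \notin codom g -> h q b = 1%R.
  move=> /negP qg; rewrite /h; case: pickP => // t /eqP gt.
  by case: qg; rewrite -gt codom_f.
have prodS (F : S -> R) : (forall q, q \notin codom g -> F q = 1%R) ->
    (\prod_t F (g t) = \prod_q F q)%R.
  move=> F1; rewrite [RHS](bigID (mem (codom g))) /= [X in (_ * X)%R]big1 // mulr1.
  have -> : (\prod_(q in codom g) F q = \prod_(q in g @: T) F q)%R.
    apply: eq_bigl => q; apply/codomP/imsetP => [[t ->]|[t _ ->]];
      by exists t.
  by rewrite big_imset //=; move=> ? ? _ _; apply: g_inj.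
(* [F] is the weight of [q] inside the subset and [G] outside it. [F] vanishes off [U], which kills
   the subsets not contained in [U] when the product is expanded. *)
pose F q : R := (if q \in U then p q * h q true else 0)%R.
pose G q : R := ((if q \in U then 1 - p q else 1) * h q false)%R.
transitivity (\prod_q (F q + G q))%R; last first.
  rewrite -prodS => [|q qg]; last first.
    rewrite /F /G; case: ifP => [/gU[t qt]|_]; last by rewrite h1 // add0r mulr1.
    by case/negP: qg; rewrite -qt codom_f.
  apply: eq_bigr => t _; rewrite /F /G !hg; case: ifP => // /negbT /fU ->.
  by rewrite -mulrDl [(p (g t) + _)%R]addrC subrK add0r.
rewrite bigA_distr [RHS](bigID (fun A : {set S} => A \subset U)) /= [X in (_ + X)%R]big1 ?addr0.
  apply: eq_bigr => A AU.
  have -> : (\prod_t f t (g t \in A) = \prod_q h q (q \in A))%R.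
    rewrite -prodS => [|q /h1 //].
    by apply: eq_bigr => t _; rewrite hg.
  rewrite big_mkcond [X in (_ * X * _)%R]big_mkcond -!big_split /=.
  apply: eq_bigr => q _; rewrite in_setD /F /G.
  have := subsetP AU q.
  by case: (q \in A) => [/(_ isT) ->|_] /=; rewrite ?mulr1 ?mul1r.
move=> A /subsetPn[q qA qU]; rewrite (bigD1 q) //= qA /F (negbTE qU).
by rewrite mul0r.
Qed.

Definition next_position k (d : {set edge k}) (n i : nat) : nat :=
  particle d n i + dimer d East (particle d n i) n.

Definition next_is k (d : {set edge k}) (z : nat -> nat -> nat) : bool :=
  [forall n : 'I_k, [forall i : 'I_n.+1, next_position d n.+1 i.+1 == z n.+1 i.+1]].

Lemma next_isP k (d : {set edge k}) z :
  reflect (forall n i, 0 < i <= n -> n <= k -> next_position d n i = z n i)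
          (next_is d z).
Proof.
apply: (iffP forallP) => [H n i|H n].
  case: n i => [|n] [|i] // ik nk.
  by have /forallP/(_ (Ordinal ik))/eqP := H (Ordinal nk).
by apply/forallP => i; apply/eqP/H => /=.
Qed.

(** Time is shuffling time: the position of level [n - 1] at Y-time [t + 1] and that of level [n] at
    Y-time [t] both have shuffling time [t + n]. Hence the neighbours are read in [z], not in
    [z']. *)
Definition step_prob (R : nzRingType) (p : nat -> nat -> R) (k : nat)
    (z z' : nat -> nat -> nat) : R :=
  (\prod_(n < k) \prod_(i < n.+1)
     let x := z n.+1 i.+1 in
     let ok b := push_step n.+1 i.+1 x (z n i.+1) (z n i) b == z' n.+1 i.+1 in
     p x n.+1 * (ok true)%:R + (1 - p x n.+1) * (ok false)%:R)%R.

Lemma push_step_eq n i x u v u' v' b :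
  (i != n -> u = u') -> (i != 1 -> v = v') ->
  push_step n i x u v b = push_step n i x u' v' b.
Proof.
rewrite /push_step; case: eqP => [_ _|_ /(_ isT) ->].
  by case: eqP => // _ /(_ isT) ->.
by case: eqP => // _ /(_ isT) ->.
Qed.

(** Each choice [A] of west-east squares yields a single covering, so exchanging the sums leaves one
    term per [A]. *)
Lemma kernel_sum (R : realType) (V : weighting R) k (d : {set edge k})
    (Q : pred {set edge k.+1}) :
  (\sum_(d' | Q d') shuffling_kernel V d d' =
   \sum_(A : {set square k.+1} |
          (A \subset uncovered_squares (slid d)) && Q (create (slid d) A))
     ((\prod_(q in A) rho V (space_coord q) (level q)) *
      \prod_(q in uncovered_squares (slid d) :\: A)
        (1 - rho V (space_coord q) (level q))))%R.
Proof.
rewrite /shuffling_kernel (exchange_big_dep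
  (fun A : {set square k.+1} => (A \subset uncovered_squares (slid d))
     && Q (create (slid d) A))) /=; last first.
  by move=> d' A Qd' /andP[AU /eqP dA]; rewrite AU -dA.
apply: eq_bigr => A /andP[AU QA].
rewrite (big_pred1 (create (slid d) A)) // => d' /=.
by rewrite AU /=; case: eqP => [->|]; rewrite ?QA ?andbF.
Qed.

Lemma prod_nat_of_bool (R : comNzRingType) (T : finType) (P : pred T) :
  (\prod_t (P t)%:R = [forall t, P t]%:R :> R)%R.
Proof.
case: forallP => [H|/existsNP[t /negP/negbTE Pt]]; last first.
  by rewrite (bigD1 t) //= Pt mul0r.
by rewrite big1 // => t _; rewrite H.
Qed.

Section KernelNext.
Variables (R : realType) (V : weighting R) (k : nat) (d : {set edge k}).
Variables (z z' : nat -> nat -> nat).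
Hypothesis dM : matching d.
Hypothesis dz : next_is d z.
Hypothesis zk : forall i, 0 < i <= k.+1 -> z k.+1 i = i.-1.

Lemma particle_create_next (A : {set square k.+1}) n i : A \subset vacant_squares d ->
  0 < i <= n -> n <= k.+1 -> particle (create (slid d) A) n i = z n i.
Proof.
move=> AV ni; rewrite leq_eqVlt => /predU1P[nk|nk].
  by rewrite nk particle_create_last // ?zk -?nk.
by rewrite particle_create //; apply: (next_isP _ _ dz).
Qed.

(** [push_step_particle] for the created covering; by [create_pair] the coin is constrained only on
    vacant squares. *)
Lemma next_push_step (A : {set square k.+1}) n i b : A \subset vacant_squares d ->
  0 < i <= n -> n <= k.+1 ->
  (vacant_at (embed d) (z n i) n -> b = dimer (create (slid d) A) East (z n i) n) ->
  next_position (create (slid d) A) n i =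
  push_step n i (z n i) (z n.-1 i) (z n.-1 i.-1) b.
Proof.
move=> AV ni nk bE; have cz := particle_create_next AV.
have cM := matching_create dM AV.
have /= := @push_step_particle _ _ n i b cM ni nk.
rewrite /next_position (cz n i) // => H.
have [xk px _] := particleP cM ni nk; rewrite cz // in xk px.
rewrite -{}H; first by apply: push_step_eq => ?; rewrite cz //; lia.
move=> hx; apply: bE; apply: (create_pair dM AV) => //; lia.
Qed.

(** The positions in [d'] are already fixed by [d]; the coins tossed to create [d'] decide the moves
    of the following step. So the event on [d'] concerns its next positions. *)
Lemma kernel_next_sum :
  (\sum_(d' | `[< matching d' >] && next_is d' z') shuffling_kernel V d d' =
   step_prob (rho V) k.+1 z z')%R.
Proof.
rewrite kernel_sum uncovered_slid //.
(* All creations have the same particle positions [z]; the one with [A] empty serves to derive their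
   properties. *)
have M0 : set0 \subset vacant_squares d by apply: sub0set.
have c0M := matching_create dM M0.
have zP n i : 0 < i <= n -> n <= k.+1 ->
    [/\ z n i < k.+1, has_particle (create (slid d) set0) n (z n i) &
        nb_below (create (slid d) set0) n (z n i) = i.-1].
  by move=> ni nk; rewrite -(particle_create_next M0) //; apply: particleP.
pose T := {n : 'I_k.+1 & 'I_n.+1}.
pose lev (t : T) : nat := (tag t).+1.
pose ind (t : T) : nat := (tagged t).+1.
have indP (t : T) : 0 < ind t <= lev t by rewrite /ind /lev /= ltn_ord.
have levP (t : T) : lev t <= k.+1 by apply: ltn_ord.
pose g (t : T) : square k.+1 := (inord (z (lev t) (ind t)), tag t).
have g_lev t : level (g t) = lev t by [].
have g_sp t : space_coord (g t) = z (lev t) (ind t).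
  by rewrite /space_coord /= inordK //; case: (zP _ _ (indP t) (levP t)).
have g_inj : injective g.
  move=> t t' gtt'.
  have ll : lev t = lev t' by rewrite -!g_lev gtt'.
  have ii : ind t = ind t'.
    have [_ _] := zP _ _ (indP t) (levP t); have [_ _] := zP _ _ (indP t') (levP t').
    by rewrite -!g_sp -gtt' ll => ->; rewrite /ind /= => ->.
  case: t t' ll ii {gtt'} => [n i] [n' i']; rewrite /lev /ind /= => -[] /val_inj nn'.
  by move: i'; rewrite -nn' => i' -[] /val_inj ->.
have gU q : q \in vacant_squares d -> exists t, g t = q.
  move=> qV; have px := part_vacant dM M0 qV.
  have xk : space_coord q < k.+1 by apply: ltn_ord.
  have nk : level q <= k.+1 by apply: ltn_ord.
  have := count_lt_size_filter_iota xk px.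
  rewrite -particlesE size_particles //; set i := nb_below _ _ _ => ik.
  exists (Tagged (fun n : 'I_k.+1 => 'I_n.+1) (Ordinal (ik : i < q.2.+1))).
  apply: square_inj; last by rewrite g_lev.
  rewrite g_sp /lev /ind /= -(particle_create_next M0) //.
  exact: particleE.
pose f (t : T) b : R := (push_step (lev t) (ind t) (z (lev t) (ind t))
   (z (lev t).-1 (ind t)) (z (lev t).-1 (ind t).-1) b == z' (lev t) (ind t))%:R%R.
transitivity (\sum_(A : {set square k.+1} | A \subset vacant_squares d)
   (\prod_(q in A) rho V (space_coord q) (level q) *
    \prod_(q in vacant_squares d :\: A) (1 - rho V (space_coord q) (level q))) *
    \prod_t f t (g t \in A))%R.
  rewrite big_mkcondr; apply: eq_bigr => A AV.
  have -> : (\prod_t f t (g t \in A) = (next_is (create (slid d) A) z')%:R :> R)%R.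
    rewrite prod_nat_of_bool; congr ((nat_of_bool _)%:R)%R.
    have fE t : (push_step (lev t) (ind t) (z (lev t) (ind t))
       (z (lev t).-1 (ind t)) (z (lev t).-1 (ind t).-1) (g t \in A)
       = next_position (create (slid d) A) (lev t) (ind t)).
      rewrite (next_push_step (b := g t \in A)) // => V0.
      by rewrite -(create_east dM AV) ?inE ?g_sp.
    apply/forallP/next_isP => [H n i|H t]; last by rewrite fE H.
    case: n i => [|n] [|i] // ik nk.
    have := H (Tagged (fun n : 'I_k.+1 => 'I_n.+1)
              (Ordinal (ik : i < (Ordinal nk).+1))).
    by rewrite fE => /eqP.
  rewrite asboolT /=; last exact: matching_create.
  by case: ifP; rewrite ?mulr1 ?mulr0.
(* At a particle off the vacant squares, both coin values give its next position in the covering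
   created from [set0]. *)
rewrite sum_subsets_prod //; last first.
  move=> t tV; rewrite /f; congr (_ == _)%:R%R.
  have V0 b : vacant_at (embed d) (z (lev t) (ind t)) (lev t) ->
     b = dimer (create (slid d) set0) East (z (lev t) (ind t)) (lev t).
    by move: tV; rewrite inE g_sp g_lev => /negbTE ->.
  by rewrite -!(next_push_step M0 _ _ (V0 _)).
rewrite /step_prob sig_big_dep /=; apply: eq_bigr => t _.
by rewrite g_sp g_lev.
Qed.
End KernelNext.

Lemma matching0 (c : {set edge 0}) : matching c.
Proof. by split=> [x n|n|x n] //; case: n. Qed.

(** The initial step is thus a transition from the empty covering of [AG_0], whose only successor
    square is vacant. *)
Lemma shuffling_kernel0 (R : realType) (V : weighting R) (c : {set edge 0})
    (d : {set edge 1}) :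
  (shuffling_kernel V c d =
   rho V 0 1 * (d == we_pair (ord0, ord0))%:R
   + (1 - rho V 0 1) * (d == ns_pair (ord0, ord0))%:R)%R.
Proof.
pose q0 : square 1 := (ord0, ord0).
have qE (q : square 1) : q = q0 by case: q => x y; rewrite !ord1.
have nb0 (q : square 1) : nb_dimers (embed c) (space_coord q) (level q) = 0.
  rewrite (qE q) /space_coord /level /= /nb_dimers dimer_embed_north.
  by rewrite dimer_embed_south0 dimer_embed_west0 dimer_embed_east !dimer_ge.
have vacT : vacant_squares c = setT.
  by apply/setP => q; rewrite !inE /vacant_at nb0 (qE q).
have slid0 s q : (s, q) \in slid c = false.
  by rewrite -dimerE dimer_slid nb0 andbF.
have createE (A : {set square 1}) :
    create (slid c) A = if q0 \in A then we_pair q0 else ns_pair q0.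
  apply/setP => -[s q].
  rewrite (mem_create (matching0 c)) ?vacT ?subsetT // slid0 in_setT (qE q).
  by case: ifP; rewrite !inE !xpair_eqE eqxx !andbT !side_eqE; case: s.
have TD0 : setT != set0 :> {set square 1}.
  by apply/negP => /eqP/setP/(_ q0); rewrite !inE.
transitivity (\sum_(d' | pred1 d d') shuffling_kernel V c d')%R.
  by rewrite big_pred1_eq.
rewrite kernel_sum (uncovered_slid (matching0 c)) vacT big_mkcond.
rewrite (bigD1 setT) //= (bigD1 set0) /=; last by rewrite eq_sym.
rewrite [X in (_ + (_ + X))%R]big1 ?addr0; last first.
  move=> A /andP[AT A0]; case q0A : (q0 \in A).
    by case/eqP: AT; apply/setP => q; rewrite (qE q) q0A in_setT.
  by case/eqP: A0; apply/setP => q; rewrite (qE q) q0A in_set0.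
have prod_q0 (F : square 1 -> R) : (\prod_(q in [set: square 1]) F q = F q0)%R.
  by rewrite (big_pred1 q0) // => q; rewrite !inE (qE q) eqxx.
rewrite !createE !subsetT !in_setT in_set0 setDT setD0 !prod_q0 !big_set0 /=.
rewrite mulr1 mul1r ![_ == d]eq_sym.
by do 2!case: (d == _); rewrite ?mulr1 ?mulr0.
Qed.

Lemma kernel_support (R : realType) (V : weighting R) k (c : {set edge k})
    (d : {set edge k.+1}) : matching c -> shuffling_kernel V c d != 0%R ->
  [/\ matching d,
      forall n i, 0 < i <= n -> n <= k -> particle d n i = next_position c n i &
      forall i, 0 < i <= k.+1 -> particle d k.+1 i = i.-1].
Proof.
move=> cM; rewrite /shuffling_kernel.
have [A /andP[AV /eqP ->] _|none] := pickP (fun A : {set square k.+1} =>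
    (A \subset uncovered_squares (slid c)) && (d == create (slid c) A)).
  rewrite (uncovered_slid cM) in AV; split.
  - exact: matching_create.
  - by move=> n i ni nk; rewrite particle_create.
  - by move=> i ik; rewrite particle_create_last.
by rewrite big_pred0 // eqxx.
Qed.

(** * Laws of the two processes *)

From mathcomp Require Import all_classical all_reals all_analysis.

Local Open Scope classical_set_scope.
Local Open Scope ring_scope.

Section FiniteValued.
Variables (R : realType) (disp : measure_display) (T : measurableType disp).
Variables (P : probability T R).

Definition fprob (F : set T) : R := fine (P F).

Lemma prE (F : set T) : measurable F -> P F = (fprob F)%:E.
Proof. by move=> mF; rewrite fineK ?fin_num_measure. Qed.

Lemma pr_ae (F F' G : set T) : measurable F -> measurable F' -> measurable G ->
  fprob (~` G) = 0 -> F `&` G = F' `&` G -> fprob F = fprob F'.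
Proof.
move=> mF mF' mG G0 FG.
have PG0 : P (~` G) = 0%E by rewrite prE ?G0 //; apply: measurableC.
have PE E : measurable E -> P E = P (E `&` G).
  move=> mE; rewrite [LHS](measureDI P mE mG) [X in (X + _)%E](_ : _ = 0%E) ?add0e //.
  apply/eqP; rewrite eq_le measure_ge0 andbT -PG0 le_measure ?inE //.
  - exact: measurableD.
  - exact: measurableC.
by rewrite /fprob (PE F) // FG -PE.
Qed.

Variables (S : finType) (X : T -> S).
Hypothesis mX : forall s, measurable (X @^-1` [set s]).

Lemma measurable_preimage_fin (A : set S) : measurable (X @^-1` A).
Proof.
have -> : X @^-1` A = \bigcup_(s in A) (X @^-1` [set s]).
  apply/seteqP; split=> [w Aw|w [s As /= ->//]].
  by exists (X w).
exact: fin_bigcup_measurable.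
Qed.

Lemma pr_fin_sum (F : set T) : measurable F ->
  fprob F = \sum_s fprob (F `&` X @^-1` [set s]).
Proof.
move=> mF; apply: EFin_inj; rewrite -prE // -sumEFin.
have {1}-> : F = \bigcup_(s in [set: S]) (F `&` X @^-1` [set s]).
  apply/seteqP; split=> [w Fw|w [s _ []//]].
  by exists (X w).
rewrite measure_fin_bigcup //.
- rewrite (fsbigE (index_enum S)) ?index_enum_uniq //.
  + by apply: congr_big => //= s; [rewrite in_setT|rewrite prE //; apply: measurableI].
  + by move=> s _; rewrite mem_index_enum.
- exact: finite_finset.
- by move=> s s' _ _ [w [[_ /= <-] [_ /= <-]]].
- by move=> s _; apply: measurableI.
Qed.

End FiniteValued.

(** * The Markov property of the shuffling for sets of coverings *)

Section ShufflingLaw.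
Variables (R : realType) (N : nat) (W : weighting R).
Variables (disp : measure_display) (T : measurableType disp).
Variables (P : probability T R) (D : forall k : nat, T -> {set edge k}).
Hypothesis shD : shuffling P N W D.

Local Notation pr := (fprob P).
Local Notation kernel k := (shuffling_kernel (UR N k.+1 W)).

Definition hist (k : nat) (A : forall l, set {set edge l}) : set T :=
  [set w | forall l, (1 <= l <= k)%N -> A l (D l w)].

Lemma measurable_dimers k (A : set {set edge k}) : (1 <= k <= N)%N ->
  measurable (D k @^-1` A).
Proof.
by move=> kN; apply: measurable_preimage_fin => s; apply: (shuffling_measurable shD).
Qed.

Lemma histS k A : hist k.+1 A = hist k A `&` D k.+1 @^-1` A k.+1.
Proof.
apply/seteqP; split=> [w H|w [H1 H2] l].
  by split=> [l lk|]; apply: H; lia.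
by move=> /andP[l0]; rewrite leq_eqVlt => /predU1P[->//|lk]; apply: H1; rewrite l0.
Qed.

Lemma hist0 A : hist 0 A = setT.
Proof. by apply/seteqP; split=> // w _ l; lia. Qed.

Lemma measurable_hist k A : (k <= N)%N -> measurable (hist k A).
Proof.
elim: k => [|k IH] kN; first by rewrite hist0.
by rewrite histS; apply: measurableI; [apply: IH; lia|apply: measurable_dimers].
Qed.

Lemma hist_restrict m k A (c : {set edge m}) : (1 <= m <= k)%N ->
  hist k A `&` D m @^-1` [set c] =
  if `[< A m c >] then hist k (eqtype.dfwith A [set c]) else set0.
Proof.
move=> mk; case: ifP => [/asboolP Ac|/negP nAc]; last first.
  apply/seteqP; split=> // w [/(_ _ mk) Aw /= Dc]; apply: nAc.
  by rewrite -Dc; apply/asboolP.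
apply/seteqP; split=> w => [[Aw Dc] l lk|H]; last first.
  have Dc : D m w = c by have := H m mk; rewrite eqtype.dfwith_in.
  split=> // l lk; have := H l lk; case: eqtype.dfwithP => //= ->.
  by [].
by move: lk; case: eqtype.dfwithP => [_|j _ lk]; [exact: Dc|exact: Aw].
Qed.

Lemma pr_hist_sum m k A : (1 <= m <= k)%N -> (k <= N)%N ->
  pr (hist k A) =
  \sum_(c | `[< A m c >]) pr (hist k (eqtype.dfwith A [set c])).
Proof.
move=> mk kN; rewrite (pr_fin_sum P (X := D m)) => [||]; last 2 first.
- by move=> s; apply: measurable_dimers; lia.
- exact: measurable_hist.
rewrite [RHS]big_mkcond; apply: eq_bigr => c _; rewrite hist_restrict //.
by case: ifP => // _; rewrite /pr measure0.
Qed.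

Lemma eq_hist k A B : (forall l, (1 <= l <= k)%N -> A l = B l) ->
  hist k A = hist k B.
Proof.
by move=> AB; apply/seteqP; split=> w H l lk; have := H l lk; rewrite AB.
Qed.

(* The law of the shuffling is given on single trajectories; the constraints on the
   first [m] coverings are relaxed to arbitrary sets one at a time. *)
Lemma markov_singletons m k A (e : forall l, {set edge l}) :
  (m < k)%N -> (k < N)%N ->
  (forall l, (m < l <= k.+1)%N -> A l = [set e l]) ->
  pr (hist k.+1 A) = pr (hist k A) * kernel k (e k) (e k.+1).
Proof.
elim: m A e => [|m IH] A e mk kN Ae.
  have hE j : (j <= k.+1)%N ->
      hist j A = [set w | forall l, (1 <= l <= j)%N -> D l w = e l].
    move=> jk; apply/seteqP; split=> w H l lj; have := H l lj;
      by rewrite Ae //; lia.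
  rewrite /fprob [in LHS]hE // (shuffling_step shD) ?mk // -hE // fineM //.
  by rewrite fin_num_measure //; apply: measurable_hist; apply: ltnW.
have mk' : (1 <= m.+1 <= k)%N by rewrite (ltnW mk).
rewrite (pr_hist_sum A mk' (ltnW kN)) (@pr_hist_sum m.+1 k.+1) ?ltnS ?(ltnW (ltnW mk)) //.
rewrite mulr_suml; apply: eq_bigr => c _.
have Ae' l : (m < l <= k.+1)%N ->
    eqtype.dfwith A [set c] l = [set eqtype.dfwith e c l].
  case: eqtype.dfwithP => [_|j mj lk]; first by rewrite eqtype.dfwith_in.
  by rewrite eqtype.dfwith_out // Ae //; move: mj; lia.
have := IH (eqtype.dfwith A [set c]) (eqtype.dfwith e c) (ltnW mk) kN Ae'.
by rewrite !(@eqtype.dfwith_out _ _ e) // neq_ltn ?mk // ltnS ltnW.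
Qed.

(** Lumping: when the kernel mass sent into [A k.+1] is the same [q] from every covering in [A k],
    it factors out of the sum over the present covering. *)
Lemma markov_sum_pos k A (q : R) : (0 < k)%N -> (k < N)%N ->
  (forall c : {set edge k}, A k c ->
    \sum_(d : {set edge k.+1} | `[< A k.+1 d >]) kernel k c d = q) ->
  pr (hist k.+1 A) = pr (hist k A) * q.
Proof.
move=> k0 kN Aq.
rewrite (@pr_hist_sum k) ?leqnn ?k0 ?leqnSn // (@pr_hist_sum k k) ?k0 ?leqnn ?(ltnW kN) //.
rewrite mulr_suml; apply: eq_bigr => c /asboolP Ac.
rewrite (@pr_hist_sum k.+1) ?leqnn // -(Aq _ Ac) mulr_sumr.
apply: eq_big => d; first by rewrite eqtype.dfwith_out // neq_ltn ltnSn.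
(* Only the times [k] and [k.+1] are restricted to single coverings, so [markov_singletons] applies
   with [m = k.-1] and the other values of [e] are arbitrary. *)
move=> _; pose e0 : forall l, {set edge l} := fun=> finset.set0.
pose e := eqtype.dfwith (eqtype.dfwith e0 c) d.
have kk1 : k != k.+1 by rewrite neq_ltn ltnSn.
have ek : e k = c by rewrite /e eqtype.dfwith_out 1?eq_sym // eqtype.dfwith_in.
have ek1 : e k.+1 = d by rewrite /e eqtype.dfwith_in.
have Ae l : (k.-1 < l <= k.+1)%N ->
    eqtype.dfwith (eqtype.dfwith A [set c]) [set d] l = [set e l].
  move=> lk; have [->|->] : l = k \/ l = k.+1 by lia.
    by rewrite eqtype.dfwith_out 1?eq_sym // eqtype.dfwith_in ek.
  by rewrite eqtype.dfwith_in ek1.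
have kk : (k.-1 < k)%N by rewrite prednK.
have := markov_singletons kk kN Ae; rewrite ek ek1 => ->.
congr (pr _ * _); apply: eq_hist => l lk.
by rewrite eqtype.dfwith_out // neq_ltn; lia.
Qed.

End ShufflingLaw.

(** * Law of the particle positions of the shuffling *)

Section ShufflingParticles.
Variables (R : realType) (N : nat) (W : weighting R).
Variables (disp : measure_display) (T : measurableType disp).
Variables (P : probability T R) (D : forall k : nat, T -> {set edge k}).
Hypothesis N0 : (0 < N)%N.
Hypothesis shD : shuffling P N W D.

Local Notation pr := (fprob P).
Local Notation kernel k := (shuffling_kernel (UR N k.+1 W)).
Local Notation hist := (hist D).

Lemma edge0_set (c c' : {set edge 0}) : c = c'.
Proof. by apply/finset.setP => -[s [[]]]. Qed.

Lemma measurable_dimers_le k (A : set {set edge k}) : (k <= N)%N ->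
  measurable (D k @^-1` A).
Proof.
case: k A => [|k] A kN; last exact: (measurable_dimers shD).
have [A0|nA] := pselect (A finset.set0).
  have -> : D 0%N @^-1` A = setT; last by [].
  by apply/seteqP; split=> // w _; rewrite /= (edge0_set (D 0%N w) finset.set0).
have -> : D 0%N @^-1` A = set0; last by [].
by apply/seteqP; split=> // w; rewrite /= (edge0_set (D 0%N w) finset.set0).
Qed.

Lemma pr_setT : pr setT = 1.
Proof. by rewrite /fprob probability_setT. Qed.

(** The two prescribed masses add up to one, so any other set of edges has probability zero. *)
Lemma pr_init (c : {set edge 0}) (d : {set edge 1}) :
  pr (D 1%N @^-1` [set d]) = kernel 0%N c d.
Proof.
rewrite shuffling_kernel0.
set we := we_pair _; set ns := ns_pair _; set p := rho _ 0 1.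
have pwe : pr (D 1%N @^-1` [set we]) = p.
  by rewrite /fprob (shuffling_init_we shD).
have pns : pr (D 1%N @^-1` [set ns]) = 1 - p.
  by rewrite /fprob (shuffling_init_ns shD).
have wens : ns != we.
  apply/negP => /eqP/finset.setP/(_ (North, (ord0, ord0))).
  by rewrite !inE !xpair_eqE !side_eqE.
have [->|dwe] := eqVneq d we; first by rewrite pwe mulr1 eq_sym (negbTE wens) mulr0 addr0.
have [->|dns] := eqVneq d ns; first by rewrite pns mulr1 mulr0 add0r.
rewrite !mulr0 addr0.
have := pr_fin_sum P (fun s => measurable_dimers_le [set s] N0) (measurableT : measurable [set: T]).
rewrite pr_setT (bigD1 we) //= (bigD1 ns) //= !setTI pwe pns.
rewrite addrA [p + _]addrC subrK -[LHS]addr0 => /addrI/esym.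
move=> /psumr_eq0P/(_ d); rewrite setTI dwe dns; apply=> // s _.
by rewrite /fprob fine_ge0.
Qed.

Lemma markov_sum k A (q : R) : (k < N)%N -> (forall c, A 0%N c) ->
  (forall c : {set edge k}, A k c ->
    \sum_(d : {set edge k.+1} | `[< A k.+1 d >]) kernel k c d = q) ->
  pr (hist k.+1 A) = pr (hist k A) * q.
Proof.
case: k => [|k] kN A0 Aq; last exact: (markov_sum_pos shD).
rewrite histS hist0 setTI pr_setT mul1r -(Aq finset.set0) //.
rewrite (pr_fin_sum P (fun s => measurable_dimers_le [set s] N0)); last first.
  exact: measurable_dimers_le.
rewrite [RHS]big_mkcond; apply: eq_bigr => d _; rewrite -pr_init.
case: ifP => [/asboolP Ad|/negP nAd].
  congr pr; apply/seteqP; split=> w /=; first by case.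
  by move=> ->.
rewrite (_ : _ `&` _ = set0) ?/fprob ?measure0 //.
by apply/seteqP; split=> // w /= [Aw dw]; apply: nAd; apply/asboolP; rewrite -dw.
Qed.

Definition tracks k (c : {set edge k}) (d : {set edge k.+1}) : Prop :=
  [/\ matching d,
      forall n i, (0 < i <= n)%N -> (n <= k)%N ->
        particle d n i = next_position c n i &
      forall i, (0 < i <= k.+1)%N -> particle d k.+1 i = i.-1].

Definition tracked k : set T :=
  [set w | forall j, (j < k)%N -> tracks (D j w) (D j.+1 w)].

Lemma measurable_pair k (Q : {set edge k} -> {set edge k.+1} -> Prop) :
  (k < N)%N -> measurable [set w | Q (D k w) (D k.+1 w)].
Proof.
move=> kN; pose X w := (D k w, D k.+1 w).
have -> : [set w | Q (D k w) (D k.+1 w)] = X @^-1` [set cd | Q cd.1 cd.2] by [].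
apply: measurable_preimage_fin => -[c d].
have -> : X @^-1` [set (c, d)] = D k @^-1` [set c] `&` D k.+1 @^-1` [set d].
  by apply/seteqP; split=> w /=; rewrite /X => -[-> ->].
by apply: measurableI; apply: measurable_dimers_le => //; apply: ltnW.
Qed.

Lemma trackedS k :
  tracked k.+1 = tracked k `&` [set w | tracks (D k w) (D k.+1 w)].
Proof.
apply/seteqP; split=> [w H|w [H1 H2] l].
  by split=> [l lk|]; apply: H; rewrite // ltnS ltnW.
by rewrite ltnS leq_eqVlt => /predU1P[->//|lk]; apply: H1.
Qed.

Lemma tracked_matching k w : tracked k w -> matching (D k w).
Proof.
case: k => [|k] H; first exact: matching0.
by have [] := H k (ltnSn k).
Qed.

Lemma measurable_tracked k : (k <= N)%N -> measurable (tracked k).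
Proof.
elim: k => [|k IH] kN; first by have -> : tracked 0 = setT by apply/seteqP; split.
by rewrite trackedS; apply: measurableI; [apply/IH/ltnW|apply: measurable_pair].
Qed.

Lemma pr_tracks k : (k < N)%N ->
  pr [set w | matching (D k w) /\ ~ tracks (D k w) (D k.+1 w)] = 0.
Proof.
move=> kN.
rewrite (pr_fin_sum P (fun s => measurable_dimers_le [set s] (ltnW kN))); last first.
  exact: (@measurable_pair _ (fun c d => matching c /\ ~ tracks c d)).
rewrite big1 // => c _.
have [cM|ncM] := pselect (matching c); last first.
  rewrite (_ : _ `&` _ = set0) ?/fprob ?measure0 //.
  by apply/seteqP; split=> // w /= [[+ _] dw]; rewrite dw.
(* [hist] starts at time 1; at [k = 0] the constraint on the present covering holds because [AG_0]
   has only one set of edges. *)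
have c0 : k = 0%N -> forall c' : {set edge k}, c' = c.
  move=> k0; move: c {cM}; rewrite k0 => c c'; exact: edge0_set.
pose A : forall l, set {set edge l} :=
  @eqtype.dfwith _ (fun l => set {set edge l})
    (@eqtype.dfwith _ (fun l => set {set edge l}) (fun=> setT) k [set c])
    k.+1 [set d : {set edge k.+1} | ~ tracks c d].
have kk1 : k.+1 != k by rewrite neq_ltn ltnSn orbT.
have Ak : A k = [set c] by rewrite /A eqtype.dfwith_out // eqtype.dfwith_in.
have Ak1 : A k.+1 = [set d | ~ tracks c d] by rewrite /A eqtype.dfwith_in.
have A1 l : l != k -> l != k.+1 -> A l = setT.
  by move=> ? ?; rewrite /A !eqtype.dfwith_out // eq_sym.
have -> : [set w | matching (D k w) /\ ~ tracks (D k w) (D k.+1 w)]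
    `&` D k @^-1` [set c] = hist k.+1 A.
  apply/seteqP; split=> [w /= [[_ nt] Dc] l lk|w H].
    have [->|lk0] := eqVneq l k; first by rewrite Ak.
    have [->|lk1] := eqVneq l k.+1; first by rewrite Ak1 /= -Dc.
    by rewrite A1.
  have Dc : D k w = c.
    have [k0|k0] := posnP k; first exact: c0.
    by have := H k; rewrite Ak k0 leqnSn; apply.
  split=> //; split; rewrite Dc //.
  by have := H k.+1; rewrite Ak1 leqnn; apply.
rewrite (@markov_sum k A 0) ?mulr0 //.
  move=> c'; have [k0|k0] := posnP k; last first.
    by rewrite A1 // eq_sym -lt0n.
  have : A k = setT by rewrite Ak; apply/seteqP; split=> // c'' _; apply: c0.
  by move: A {A1 Ak Ak1}; rewrite k0 => A ->.
rewrite Ak => c' ->; apply: big1 => d /asboolP; rewrite Ak1 /= => nt.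
apply/eqP/negPn/negP => /(kernel_support cM) [dM dp dl]; exact: nt.
Qed.

Lemma pr_not_tracked k : (k <= N)%N -> pr (~` tracked k) = 0.
Proof.
elim: k => [|k IH] kN.
  have -> : tracked 0 = setT by apply/seteqP; split.
  by rewrite setCT /fprob measure0.
have mB : measurable [set w | matching (D k w) /\ ~ tracks (D k w) (D k.+1 w)].
  exact: (@measurable_pair _ (fun c d => matching c /\ ~ tracks c d)).
have PB0 := prE P mB; rewrite (pr_tracks kN) in PB0.
have -> : ~` tracked k.+1 = ~` tracked k `|`
    [set w | matching (D k w) /\ ~ tracks (D k w) (D k.+1 w)].
  rewrite trackedS setCI; apply/seteqP; split=> w; last first.
    by case=> [?|[_ ?]]; [left|right].
  case=> [?|nt]; first by left.
  have [Hw|] := pselect (tracked k w); last by left.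
  by right; split=> //; apply: tracked_matching.
have mA : measurable (~` tracked k).
  by apply: measurableC; apply: measurable_tracked; apply: ltnW.
by rewrite /fprob (measureU0 mA mB PB0); apply: (IH (ltnW kN)).
Qed.

(** The constraint at time [l] prescribes the positions at time [l + 1]; by [kernel_next_sum] the
    conditional probability of the next constraint is the same for all admissible coverings, as
    [markov_sum] requires. *)
Lemma pr_hist_prod (z : nat -> nat -> nat -> nat) k : (k < N)%N ->
  (forall t i, (0 < i <= t)%N -> (t <= N)%N -> z t t i = i.-1) ->
  pr (hist k (fun l => [set d | matching d /\ next_is d (z l.+1)])) =
  \prod_(l < k) step_prob (rho (UR N l.+1 W)) l.+1 (z l.+1) (z l.+2).
Proof.
move=> + zd; elim: k => [|k IH] kN; first by rewrite hist0 pr_setT big_ord0.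
rewrite big_ord_recr -IH 1?ltnW //=; apply: markov_sum; first exact: ltnW.
  move=> c; split; first exact: matching0.
  by apply/next_isP => -[|n] [|i].
move=> c [cM cz].
rewrite -(kernel_next_sum (UR N k.+1 W) _ cM cz); last first.
  by move=> i ik; apply: zd => //; apply: ltnW.
apply: eq_bigl => d; rewrite asbool_and; congr (_ && _).
exact: asboolb.
Qed.

Definition particles_at (z : nat -> nat -> nat -> nat) : set T :=
  [set w | forall t n i, (0 < i <= n)%N -> (n <= t)%N -> (t <= N)%N ->
     particle (D t w) n i = z t n i].

Lemma particles_atS z : particles_at z = \bigcap_(t in `I_N.+1)
   D t @^-1` [set d | forall n i, (0 < i <= n)%N -> (n <= t)%N ->
      particle d n i = z t n i].
Proof.
apply/seteqP; split=> [w H t tN n i|w H t n i ni nt tN]; last exact: (H t tN).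
by move=> ni nt; apply: H.
Qed.

Lemma measurable_particles_at z : measurable (particles_at z).
Proof.
rewrite particles_atS; apply: fin_bigcap_measurable => [|t tN].
  exact: finite_II.
exact: measurable_dimers_le.
Qed.

(** On the almost sure event [tracked N] the positions at time [l + 1] are the next positions of
    [D l] together with a full top level, so the event coincides with the one of [pr_hist_prod] at
    [N.-1]. *)
Lemma pr_particles_at z :
  (forall t i, (0 < i <= t)%N -> (t <= N)%N -> z t t i = i.-1) ->
  pr (particles_at z) =
  \prod_(l < N.-1) step_prob (rho (UR N l.+1 W)) l.+1 (z l.+1) (z l.+2).
Proof.
move=> zd; rewrite -pr_hist_prod ?prednK //.
apply: (pr_ae _ _ (measurable_tracked (leqnn N)) (pr_not_tracked (leqnn N))).
- exact: measurable_particles_at.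
- by apply: (measurable_hist shD); rewrite leq_pred.
apply/seteqP; split=> w [H G]; split=> //.
  move=> l lN; have lN' : (l < N)%N by lia.
  have [_ dp _] := G l lN'; split.
    by case: l lN lN' {dp} => // l lN lN'; have [] := G l (ltnW lN').
  by apply/next_isP => n i ni nl; rewrite -dp //; apply: H => //; apply: leqW.
move=> t n i ni nt tN.
case: t nt tN => [|t] nt tN; first by move: ni nt; lia.
have [_ dp dl] := G t tN.
move: nt; rewrite leq_eqVlt => /predU1P[nt|nt].
  by rewrite nt in ni *; rewrite dl // zd.
have [|_ /next_isP dn] := H t; first by move: ni nt tN; lia.
by rewrite dp // dn.
Qed.

Lemma pr_particles_at0 z :
  (exists t i, [/\ (0 < i <= t)%N, (t <= N)%N & z t t i <> i.-1]) ->
  pr (particles_at z) = 0.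
Proof.
move=> [t [i [it tN zti]]].
have <- : pr set0 = 0 by rewrite /fprob measure0.
apply: (pr_ae _ _ (measurable_tracked (leqnn N)) (pr_not_tracked (leqnn N))) => //.
  exact: measurable_particles_at.
rewrite set0I; apply/seteqP; split=> // w [H G].
case: t it tN zti => [|t] it tN zti; first by move: it; lia.
have [_ _ dl] := G t tN; apply: zti.
by rewrite -dl // H.
Qed.

End ShufflingParticles.

(** * Law of the trajectories of the push-block process *)

Section PushBlock.
Variables (R : realType) (N : nat) (W : weighting R).
Variables (disp : measure_display) (T : measurableType disp).
Variables (P : probability T R).
Variables (B : nat * nat * nat * nat -> {RV P >-> bool}).
Variables (Y : nat -> nat -> nat -> T -> nat).
Hypothesis jB : jump_variables N W B.
Hypothesis pbY : push_block N (fun p w => B p w) Y.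

(** The infinite conventions disappear: [-oo] becomes 0 in a maximum of naturals, and [+oo] becomes
    a skipped minimum. *)
Lemma push_blockE n i t w : (1 <= i <= n)%N -> (t + n < N)%N ->
  Y n i t.+1 w = push_step n i (Y n i t w) (Y n.-1 i t.+1 w)
    (Y n.-1 i.-1 t.+1 w) (B (t, i, n, Y n i t w) w).
Proof.
move=> ni tn; have /= := (proj2 pbY) n i t w ni tn.
have n0 : (0 < n)%N by lia.
rewrite /ext_position prednK //.
have -> : (i == 0%N) = false by lia.
have -> : (i == n.+1) = false by lia.
have -> : (i.-1 == n) = false by lia.
have -> : (i.-1 == 0%N) = (i == 1%N) by lia.
rewrite /push_step; set b := nat_of_bool _.
set u := Y n.-1 i t.+1 w; set v := Y n.-1 i.-1 t.+1 w; set x := Y n i t w.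
have -> : Order.max ((x%:Z)%:E + (b%:Z)%:E)%E
    ((if i == 1%N then -oo else (v%:Z)%:E) + 1%:E)%E =
    ((maxn (x + b) (if i == 1%N then 0%N else v.+1))%:Z)%:E.
  case: ifP => _; first by rewrite maxn0 addNye maxeNy -EFinD.
  by rewrite -!EFinD -EFin_max; congr (_%:E); lia.
case: ifP => _; first by rewrite minye => -[].
by rewrite -EFin_min => -[]; lia.
Qed.

(** This bound keeps every coin that is read inside [jump_index N]. *)
Lemma push_block_lt t n i w : (0 < i <= n)%N -> (n <= t)%N -> (t <= N)%N ->
  (Y n i (t - n)%N w < t)%N.
Proof.
elim: t n i => [|t IH] n i ni nt tN; first by move: ni nt; lia.
move: nt; rewrite leq_eqVlt => /predU1P[nt|nt].
  by rewrite nt in ni *; rewrite subnn (proj1 pbY) //; lia.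
rewrite subSn // push_blockE //; last by lia.
have x := IH n i ni nt (ltnW tN).
have v : (1 < i -> Y n.-1 i.-1 (t - n).+1 w < t)%N.
  move=> i1; have -> : (t - n).+1 = (t - n.-1)%N by lia.
  by apply: IH; lia.
rewrite /push_step; case: (B _ w); case: eqP => _; case: eqP => i1; lia.
Qed.

Definition positions_at (z : nat -> nat -> nat -> nat) : set T :=
  [set w | forall t n i, (0 < i <= n)%N -> (n <= t)%N -> (t <= N)%N ->
     Y n i (t - n)%N w = z t n i].

Definition update_ok (z : nat -> nat -> nat -> nat)
    (p : nat * nat * nat * nat) (b : bool) : bool :=
  let: (a, i, n, x) := p in
  push_step n i x (z (a + n)%N n.-1 i) (z (a + n)%N n.-1 i.-1) b
    == z (a + n).+1 n i.

(** Along the trajectory [z] the coins are read at deterministic places. The event thus becomes an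
    intersection of conditions on one fixed coin each, although [Y] reads its coins at random
    positions. *)
Lemma positions_at_updates z :
  (forall t i, (0 < i <= t)%N -> (t <= N)%N -> z t t i = i.-1) ->
  positions_at z =
  [set w | forall t n i, (0 < i <= n)%N -> (n <= t)%N -> (t < N)%N ->
     let p := ((t - n)%N, i, n, z t n i) in update_ok z p (B p w)].
Proof.
move=> zd; apply/seteqP; split=> w H /=.
  move=> t n i ni nt tN; rewrite subnK //.
  have tnN : (t - n + n < N)%N by rewrite subnK.
  have := push_blockE w ni tnN.
  have -> : Y n i (t - n).+1 w = z t.+1 n i.
    by rewrite -subSn //; apply: H => //; apply: leqW.
  rewrite (H t n i) // 1?ltnW // => ->.
  have tn1 : (t - n).+1 = (t - n.-1)%N by lia.
  by apply/eqP/push_step_eq => in1; rewrite tn1; symmetry; apply: H; lia.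
(* Induction on shuffling time, for all levels at once: the neighbours of level [n - 1] at Y-time
   [t - n + 1] have shuffling time [t], hence are given by [IH]. *)
elim=> [|t IH] n i ni nt tN; first by move: ni nt; lia.
move: nt; rewrite leq_eqVlt => /predU1P[nt|nt].
  by rewrite nt in ni *; rewrite subnn (proj1 pbY) ?zd //; lia.
have /= := H t n i ni nt tN; rewrite subnK // => /eqP <-.
rewrite subSn // push_blockE //; last by lia.
rewrite (IH n i) // 1?ltnW //; apply: push_step_eq => in1.
  have -> : (t - n).+1 = (t - n.-1)%N by lia.
  by apply: IH; lia.
have -> : (t - n).+1 = (t - n.-1)%N by lia.
by apply: IH; lia.
Qed.

Lemma measurable_jump p (A : set bool) : measurable (B p @^-1` A).
Proof. exact: measurable_funPTI. Qed.

Lemma prob_jump p (r : R) (f : bool -> bool) :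
  P (B p @^-1` [set true]) = r%:E ->
  P (B p @^-1` [set b | f b]) =
  (r * (f true)%:R + (1 - r) * (f false)%:R)%:E.
Proof.
move=> Bp.
have pT : fprob P (B p @^-1` [set true]) = r by rewrite /fprob Bp.
have pF : fprob P (B p @^-1` [set false]) = 1 - r.
  have := pr_fin_sum P (fun b => measurable_jump p [set b])
    (measurableT : measurable [set: T]).
  rewrite big_bool !setTI pT {1}/fprob probability_setT /= => ->.
  by rewrite [r + _]addrC addrK.
rewrite prE; last exact: measurable_jump.
congr (_%:E); rewrite (pr_fin_sum P (fun b => measurable_jump p [set b]));
  last exact: measurable_jump.
have cond b : fprob P (B p @^-1` [set b0 | f b0] `&` B p @^-1` [set b]) =
    fprob P (B p @^-1` [set b]) * (f b)%:R.
  case fb : (f b); last first.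
    rewrite mulr0 (_ : _ `&` _ = set0) ?/fprob ?measure0 //.
    by apply/seteqP; split=> // w /= [+ wb]; rewrite wb fb.
  rewrite mulr1; congr (fprob P _); apply/seteqP; split=> w /=; first by case.
  by move=> wb; rewrite wb.
by rewrite big_bool !cond pT pF.
Qed.

Definition time_index : finType :=
  {l : 'I_N.-1 & {n : 'I_l.+1 & 'I_n.+1}}.

Definition jump_of (z : nat -> nat -> nat -> nat) (k : time_index) :
    nat * nat * nat * nat :=
  let t := (tag k).+1 in let n := (tag (tagged k)).+1 in
  let i := (tagged (tagged k)).+1 in ((t - n)%N, i, n, z t n i).

(** The first three components determine the update, whatever [z] is. *)
Lemma jump_of_inj z : injective (jump_of z).
Proof.
move=> [l [n i]] [l' [n' i']]; rewrite /jump_of /= => -[tn ii nn _].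
have ll : l = l'.
  by apply: val_inj; have := ltn_ord n; have := ltn_ord n'; move: tn nn => /=; lia.
subst l'; have nn' : n = n' by apply: val_inj.
by subst n'; have -> : i = i' by apply: val_inj.
Qed.

(** Independence applies to the coins read along [z]: they are distinct by [jump_of_inj] and
    admissible by the bound on [z]. *)
Lemma prob_positions_at z :
  (forall t i, (0 < i <= t)%N -> (t <= N)%N -> z t t i = i.-1) ->
  (forall t n i, (0 < i <= n)%N -> (n <= t)%N -> (t < N)%N -> (z t n i < t)%N) ->
  measurable (positions_at z) /\
  fprob P (positions_at z) =
  \prod_(l < N.-1) step_prob (rho (UR N l.+1 W)) l.+1 (z l.+1) (z l.+2).
Proof.
move=> zd zlt.
pose J : {fset nat * nat * nat * nat} :=
  seq_fset tt [seq jump_of z k | k : time_index].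
have J_jump p : p \in J -> jump_index N p /\
    exists t n i, [/\ (0 < i <= n)%N, (n <= t)%N, (t < N)%N &
      p = ((t - n)%N, i, n, z t n i)].
  rewrite seq_fsetE => /mapP[[l [n i]] _ ->].
  have := ltn_ord l; have := ltn_ord n; have := ltn_ord i => /= iP nP lP.
  split.
    rewrite /jump_index /jump_of /= subnK //.
    by apply/and3P; split; [lia|lia|apply: zlt; lia].
  by exists l.+1, n.+1, i.+1; split; rewrite //=; lia.
have J_mem t n i : (0 < i <= n)%N -> (n <= t)%N -> (t < N)%N ->
    ((t - n)%N, i, n, z t n i) \in J.
  case: t n i => [|t] [|n] [|i] // ni nt tN.
  have tN' : (t < N.-1)%N by lia.
  rewrite seq_fsetE; apply/mapP.
  exists (Tagged (fun l : 'I_N.-1 => {n : 'I_l.+1 & 'I_n.+1})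
    (i := Ordinal tN') (Tagged (fun n : 'I_t.+1 => 'I_n.+1)
    (i := Ordinal (nt : (n < t.+1)%N)) (Ordinal (ni : (i < n.+1)%N)))) => //.
  by rewrite mem_enum.
pose A p : set bool := [set b | update_ok z p b].
have posE : positions_at z = \bigcap_(p in [set` J]) (B p @^-1` A p).
  rewrite positions_at_updates //; apply/seteqP; split=> w H.
    by move=> p /= /J_jump[_ [t [n [i [ni nt tN ->]]]]]; apply: H.
  by move=> t n i ni nt tN; exact: (H _ (J_mem t n i ni nt tN)).
split.
  rewrite posE; apply: fin_bigcap_measurable; first exact: finite_fset.
  by move=> p _; apply: measurable_jump.
have [indep law] := jB.
rewrite posE /fprob indep; last by move=> p /J_jump[].
have AE p : p \in J -> P (B p @^-1` A p) =
    (let r := let: (a, i, n, x) := p in rho (UR N (a + n) W) x n in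
     r * (update_ok z p true)%:R + (1 - r) * (update_ok z p false)%:R)%:E.
  move=> /J_jump[+ _]; case: p => [[[a i] n] x] pJ.
  by apply: prob_jump; apply: law.
rewrite (eq_big_seq _ AE) prodEFin /=.
rewrite (perm_big _ (seq_fset_perm tt _)) undup_id; last first.
  by rewrite map_inj_uniq ?enum_uniq //; apply: jump_of_inj.
rewrite big_map big_enum /=.
under [RHS]eq_bigr do rewrite /step_prob sig_big_dep.
rewrite sig_big_dep; apply: eq_bigr => -[l [n i]] _ /=.
have nl := ltn_ord n; have E : (l.+1 - n.+1 + n.+1 = l.+1)%N by rewrite subnK.
by rewrite E.
Qed.
End PushBlock.

(** * Comparison of the two laws *)

Lemma positions_at_impossible (R : realType) (N : nat)
    (disp : measure_display) (T : measurableType disp) (P : probability T R)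
    (B : nat * nat * nat * nat -> {RV P >-> bool})
    (Y : nat -> nat -> nat -> T -> nat) z :
  push_block N (fun p w => B p w) Y ->
  (exists t n i, [/\ (0 < i <= n)%N, (n <= t)%N, (t <= N)%N &
     (t <= z t n i)%N \/ n = t /\ z t n i <> i.-1]) ->
  positions_at N Y z = set0.
Proof.
move=> pbY [t [n [i [ni nt tN zt]]]]; apply/seteqP; split=> // w H.
have zE := H t n i ni nt tN; case: zt => [zt|[nt' zt]].
  by have := push_block_lt pbY w ni nt tN; rewrite zE ltnNge zt.
by apply: zt; rewrite -zE nt' subnn (proj1 pbY) // -nt'.
Qed.

Lemma particle_lt_size k (d : {set edge k}) n i : (0 < k)%N ->
  (particle d n i < k)%N.
Proof.
move=> k0; rewrite /particle; have [ik|ik] := ltnP i.-1 (size (particles d n)).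
  by have := mem_nth 0%N ik; rewrite mem_filter mem_iota => /and3P[].
by rewrite nth_default.
Qed.

Lemma particles_at_impossible (disp : measure_display)
    (T : measurableType disp) (N : nat)
    (D : forall k : nat, T -> {set edge k}) z :
  (exists t n i, [/\ (0 < i <= n)%N, (n <= t)%N, (t <= N)%N &
     (t <= z t n i)%N]) ->
  particles_at N D z = set0.
Proof.
move=> [t [n [i [ni nt tN zt]]]]; apply/seteqP; split=> // w H.
have := H t n i ni nt tN; have : (0 < t)%N by move: ni nt; lia.
by move=> /(particle_lt_size (D t w) n i) + E; rewrite E ltnNge zt.
Qed.

Definition array_value N (z : {ffun array_index N -> nat}) (t n i : nat) : nat :=
  if insub (inord n, inord i, inord t) is Some p then z p else 0%N.

Lemma array_valueP N (f : nat -> nat -> nat -> nat)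
    (z : {ffun array_index N -> nat}) :
  array N f = z <-> forall t n i, (0 < i <= n)%N -> (n <= t)%N -> (t <= N)%N ->
    f n i t = array_value z t n i.
Proof.
split=> [<- t n i ni nt tN|H].
  rewrite /array_value insubT /=; first by rewrite !inordK //; lia.
  by move=> p; rewrite ffunE /= !inordK //; lia.
apply/ffunP => -[[[n i] t] p]; rewrite ffunE /=.
have /and3P[i0 ni nt] : valid_index (n, i, t) := p.
rewrite H ?i0 //; last by rewrite -ltnS.
rewrite /array_value !inord_val insubT.
by congr (z _); apply: val_inj.
Qed.

(** Bounded arrays take finitely many values, so every set [A] has a measurable preimage and the
    laws are determined by single arrays. *)
Lemma equal_in_law_fin (R : realType) (d1 d2 : measure_display)
    (T1 : measurableType d1) (T2 : measurableType d2)
    (P1 : probability T1 R) (P2 : probability T2 R) (I : finType) (N : nat)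
    (X1 : T1 -> {ffun I -> nat}) (X2 : T2 -> {ffun I -> nat}) :
  (forall w p, (X1 w p <= N)%N) -> (forall w p, (X2 w p <= N)%N) ->
  (forall z, [/\ measurable (X1 @^-1` [set z]), measurable (X2 @^-1` [set z]) &
     fprob P1 (X1 @^-1` [set z]) = fprob P2 (X2 @^-1` [set z])]) ->
  equal_in_law P1 P2 X1 X2.
Proof.
move=> X1N X2N XE A.
pose cut (z : {ffun I -> nat}) : {ffun I -> 'I_N.+1} := [ffun p => inord (z p)].
pose emb (s : {ffun I -> 'I_N.+1}) : {ffun I -> nat} := [ffun p => s p : nat].
have cutK (z : {ffun I -> nat}) : (forall p, (z p <= N)%N) -> emb (cut z) = z.
  by move=> zN; apply/ffunP => p; rewrite !ffunE inordK ?ltnS.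
have embK (s : {ffun I -> 'I_N.+1}) : cut (emb s) = s.
  by apply/ffunP => p; rewrite !ffunE inord_val.
have cutE (T : Type) (X : T -> {ffun I -> nat}) s : (forall w p, (X w p <= N)%N) ->
    (cut \o X) @^-1` [set s] = X @^-1` [set emb s].
  move=> XN; apply/seteqP; split=> w /=; last by move=> ->.
  by move=> <-; rewrite cutK.
have preE (T : Type) (X : T -> {ffun I -> nat}) : (forall w p, (X w p <= N)%N) ->
    X @^-1` A = (cut \o X) @^-1` (emb @^-1` A).
  by move=> XN; apply/seteqP; split=> w /=; rewrite cutK.
have m1 s : measurable ((cut \o X1) @^-1` [set s]).
  by rewrite cutE //; have [] := XE (emb s).
have m2 s : measurable ((cut \o X2) @^-1` [set s]).
  by rewrite cutE //; have [] := XE (emb s).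
rewrite (preE _ X1) // (preE _ X2) //.
have mA1 := measurable_preimage_fin m1 (emb @^-1` A).
have mA2 := measurable_preimage_fin m2 (emb @^-1` A).
rewrite !prE //; congr (_%:E).
rewrite (pr_fin_sum P1 m1 mA1) (pr_fin_sum P2 m2 mA2); apply: eq_bigr => s _.
have [As|nAs] := pselect (A (emb s)); last first.
  rewrite (_ : _ `&` _ = set0); last first.
    by apply/seteqP; split=> // w /= [+ ws]; rewrite ws.
  rewrite (_ : _ `&` _ = set0); last first.
    by apply/seteqP; split=> // w /= [+ ws]; rewrite ws.
  by rewrite /fprob !measure0.
rewrite !(@setIidr _ _ (_ @^-1` [set s])); last 2 first.
- by move=> w /= ->.
- by move=> w /= ->.
by rewrite !cutE //; have [] := XE (emb s).
Qed.

Theorem proposition12p8 (R : realType) (N : nat) (W : weighting R)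
  (dX dY : measure_display) (TX : measurableType dX) (TY : measurableType dY)
  (PX : probability TX R) (PY : probability TY R)
  (D : forall k : nat, TX -> {set edge k})
  (B : nat * nat * nat * nat -> {RV PY >-> bool})
  (Y : nat -> nat -> nat -> TY -> nat) :
  (1 <= N)%N ->
  positive_weighting N W ->
  shuffling PX N W D ->
  jump_variables N W B ->
  push_block N (fun p w => B p w) Y ->
  equal_in_law PY PX
    (fun w => array N (fun j i t => Y j i (t - j)%N w))
    (fun w => array N (fun j i t => particle (D t w) j i)).
Proof.
move=> N1 _ shD jB pbY.
apply: (@equal_in_law_fin _ _ _ _ _ _ _ _ N) => [w p|w p|z].
- rewrite ffunE; case: p => [[[n i] t] /= p].
  have /and3P[i0 ni nt] : valid_index (n, i, t) := p.
  have tN : (t <= N)%N by rewrite -ltnS.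
  have ni' : (0 < i <= n)%N by rewrite i0.
  exact: leq_trans (ltnW (push_block_lt pbY w ni' nt tN)) tN.
- rewrite ffunE; case: p => [[[n i] t] /= p].
  have /and3P[i0 ni nt] : valid_index (n, i, t) := p.
  have tN : (t <= N)%N by rewrite -ltnS.
  by apply: leq_trans tN; apply/ltnW/particle_lt_size; lia.
set EY := _ @^-1` _; set EX := _ @^-1` _.
pose zf := array_value z.
have -> : EY = positions_at N Y zf.
  by apply/seteqP; split=> w /array_valueP.
have -> : EX = particles_at N D zf.
  by apply/seteqP; split=> w /array_valueP.
have mX := measurable_particles_at shD zf.
(* An array with a position outside its [AG_t], or, in the next case, with a level not packed at its
   first time, has probability zero on both sides. *)
have [[t [n [i [ni nt tN zt]]]]|bounded] := pselect (exists t n i,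
    [/\ (0 < i <= n)%N, (n <= t)%N, (t <= N)%N & (t <= zf t n i)%N]).
  rewrite (positions_at_impossible pbY); last by exists t, n, i; split=> //; left.
  rewrite particles_at_impossible; last by exists t, n, i.
  by rewrite /fprob !measure0; split.
have [[t [i [it tN zt]]]|packed] := pselect (exists t i,
    [/\ (0 < i <= t)%N, (t <= N)%N & zf t t i <> i.-1]).
  rewrite (positions_at_impossible pbY); last by exists t, t, i; split=> //; right.
  rewrite (pr_particles_at0 N1 shD); last by exists t, i.
  by rewrite /fprob !measure0; split.
have zd t i : (0 < i <= t)%N -> (t <= N)%N -> zf t t i = i.-1.
  by move=> it tN; apply: contrapT => zt; apply: packed; exists t, i.
have [||mY ->] := prob_positions_at jB pbY (z := zf) => //.
  move=> t n i ni nt tN; rewrite ltnNge; apply/negP => zt.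
  by apply: bounded; exists t, n, i; split=> //; apply: ltnW.
by rewrite (pr_particles_at N1 shD).

Qed.
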